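(* Let $n\ge1$, let $H$ be a complex Hilbert space and let $T_1,\dots,T_n\in\mathcal{B}(H)$ have joint numerical radius $w_J(T_1,\dots,T_n)\le1$. Let $\Psi:\mathcal{A}_n\to\mathcal{B}(H)$ be the map given by $\Psi(p)=p(T_1,\dots,T_n)$ for $p\in\mathcal{P}_n$ (extended by continuity from the dense subalgebra $\mathcal{P}_n$ to $\mathcal{A}_n$). Then $\|\Psi\|\le2$ and $\|\Psi\|_w\le\frac54$.
   Context: Free semigroup: $\mathbb{F}_n^+$ is the free semigroup with generators $g_1,\dots,g_n$ and identity $g_0$; the length is $|\alpha|=k$ if $\alpha=g_{i_1}\cdots g_{i_k}$, and $|g_0|=0$. Joint numerical radius: $$w_J(T_1,\dots,T_n)=\sup\left|\sum_{\alpha\in\mathbb{F}_n^+}\sum_{j=1}^n\langle h_\alpha,T_jh_{g_j\alpha}\rangle\right|,$$ the supremum being over all families $\{h_\alpha:\alpha\in\mathbb{F}_n^+\}\subset H$ with $\sum_{\alpha}\|h_\alpha\|^2=1$. Fock space and noncommutative disc algebra: $H_n$ is an $n$-dimensional Hilbert space with orthonormal basis $e_1,\dots,e_n$, and $F^2(H_n)=\bigoplus_{k\ge0}H_n^{\otimes k}$ (with $H_n^{\otimes0}=\mathbb{C}1$) is the full Fock space, with norm $\|\cdot\|_2$. For $\alpha=g_{i_1}\cdots g_{i_k}$ put $e_\alpha=e_{i_1}\otimes\cdots\otimes e_{i_k}$, and $e_{g_0}=1$. $\mathcal{P}_n$ is the set of all finite sums $p=\sum_{|\alpha|\le m}a_\alpha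 e_\alpha$ with $m\in\mathbb{N}$, $a_\alpha\in\mathbb{C}$, an algebra (noncommutative polynomials) under the product $p\otimes q$. $F_n^\infty$ is the set of $g\in F^2(H_n)$ with $\|g\|_\infty:=\sup\{\|g\otimes p\|_2:p\in\mathcal{P}_n,\|p\|_2\le1\}<\infty$. $\mathcal{A}_n$ is the closure of $\mathcal{P}_n$ in $(F_n^\infty,\|\cdot\|_\infty)$. Evaluation: for $\alpha=g_{i_1}\cdots g_{i_k}$ put $T_\alpha=T_{i_1}\cdots T_{i_k}$, and $T_{g_0}=I$; for $p=\sum_{|\alpha|\le m}a_\alpha e_\alpha\in\mathcal{P}_n$, $p(T_1,\dots,T_n)=\sum_{|\alpha|\le m}a_\alpha T_\alpha$. Norms: $\|\Psi\|=\sup\{\|\Psi(a)\|:a\in\mathcal{A}_n,\|a\|_\infty\le1\}$ and $\|\Psi\|_w=\sup\{w(\Psi(a)):a\in\mathcal{A}_n,\|a\|_\infty\le1\}$, where $w(A)=\sup\{|\langle Ax,x\rangle|:\|x\|=1\}$ is the numerical radius. Part of the assertion is that $p\mapsto p(T_1,\dots,T_n)$ is bounded on $(\mathcal{P}_n,\|\cdot\|_\infty)$, so that the extension $\Psi$ exists; equivalently, the two bounds hold for $\Psi$ on $\mathcal{P}_n$. *)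

(* Defs.v *)
From HB Require Import structures.
From mathcomp Require Import all_boot all_order all_algebra finmap.
From mathcomp Require Import sesquilinear complex.
From mathcomp Require Import mathcomp_extra boolp classical_sets functions.
From mathcomp Require Import cardinality fsbigop reals ereal.
From mathcomp Require Import topology normedtype sequences esum exp.
From mathcomp Require summability.

Set Implicit Arguments.
Unset Strict Implicit.
Unset Printing Implicit Defensive.

Import Order.TTheory GRing.Theory Num.Theory.
Import numFieldNormedType.Exports.

Local Open Scope classical_set_scope.
Local Open Scope ring_scope.
Local Open Scope complex_scope.

(* Norms of normed spaces over R[i] take their values in R[i] (in its
   nonnegative real axis); [rnorm] is the same number seen in R. *)
Definition rnorm (R : realType) (V : normedZmodType R[i]) (x : V) : R :=
  complex.Re `|x|.

(* B(H). *)
Record bounded_op (R : realType) (H : normedModType R[i]) := BoundedOp {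
  bounded_op_fun :> {linear H -> H};
  bounded_op_continuous : continuous bounded_op_fun }.

Definition opnorm (R : realType) (H : normedModType R[i]) (A : H -> H) :
    \bar R :=
  ereal_sup [set (rnorm (A x))%:E | x in [set x : H | rnorm x <= 1]].

Definition numerical_radius (R : realType) (H : normedModType R[i])
    (dot : H -> H -> R[i]) (A : H -> H) : \bar R :=
  ereal_sup [set (rnorm (dot (A x) x))%:E | x in [set x : H | rnorm x = 1]].

(* The free semigroup on n generators: g_j alpha is [j :: alpha], the identity
   g_0 is [::], the product is concatenation, the length is [size]. *)
Definition word (n : nat) := seq 'I_n.

(* [summability.sum] is the limit of the finite partial sums along the directed
   set of all finite sets of words. The series converges absolutely, as the
   T_j are bounded. *)
Definition joint_numerical_radius (R : realType) (H : normedModType R[i])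
    (dot : H -> H -> R[i]) (n : nat) (T : 'I_n -> H -> H) : \bar R :=
  ereal_sup
    [set (rnorm (summability.sum (R := R[i]^o)
            (fun alpha : word n =>
               \sum_(j < n) dot (h alpha) (T j (h (j :: alpha))))))%:E
    | h in [set h : word n -> H |
            (\esum_(alpha in [set: word n]) (rnorm (h alpha) ^+ 2)%:E
             = 1)%E]].

Section Fock.
Variables (R : realType) (n : nat).

(* An element sum_alpha a_alpha e_alpha of the full Fock space is represented
   by its family of coefficients a_alpha in the orthonormal basis (e_alpha);
   [fock] below consists of the square-summable families. *)
Implicit Types f g p : word n -> R[i].

Definition norm2 f : \bar R :=
  ((\esum_(alpha in [set: word n]) (rnorm (f alpha) ^+ 2)%:E) `^ 2^-1)%E.

Definition fock : set (word n -> R[i]) := [set f | (norm2 f < +oo)%E].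

Definition ncpoly : set (word n -> R[i]) :=
  [set p | exists m : nat, forall alpha, (m < size alpha)%N -> p alpha = 0].

(* Since e_alpha (x) e_beta = e_(alpha beta), the coefficient of f (x) g at
   gamma is the sum of f_alpha g_beta over all factorizations
   gamma = alpha beta. *)
Definition tensor f g : word n -> R[i] :=
  fun gamma => \sum_(k < (size gamma).+1) f (take k gamma) * g (drop k gamma).

Definition norm_infty g : \bar R :=
  ereal_sup
    [set norm2 (tensor g p) | p in [set p | ncpoly p /\ (norm2 p <= 1)%E]].

Definition F_infty : set (word n -> R[i]) :=
  [set g | fock g /\ (norm_infty g < +oo)%E].

Definition disc_algebra : set (word n -> R[i]) :=
  [set a | F_infty a /\
    forall e : R, 0 < e ->
      exists2 p, ncpoly p & (norm_infty (a \- p)%R < e%:E)%E].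

End Fock.

Arguments disc_algebra : clear implicits.

Definition word_op (R : realType) (H : normedModType R[i]) (n : nat)
    (T : 'I_n -> H -> H) (alpha : word n) : H -> H :=
  fun x => foldr (fun i y => T i y) x alpha.

(* A sum over the finite support; meaningful for p in [ncpoly]. *)
Definition ncpoly_eval (R : realType) (H : normedModType R[i]) (n : nat)
    (T : 'I_n -> H -> H) (p : word n -> R[i]) : H -> H :=
  fun x => \sum_(alpha \in [set: word n]) p alpha *: word_op T alpha x.

Section Calculus.
Variables (R : realType) (H : normedModType R[i]) (n : nat).
Implicit Type Psi : disc_algebra R n -> bounded_op H.

(* Psi extends p |-> p(T_1, ..., T_n) and is continuous from
   (A_n, norm_infty) to (B(H), opnorm). *)
Definition continuous_extension (T : 'I_n -> bounded_op H) Psi : Prop :=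
  (forall a, ncpoly (\val a) -> Psi a =1 ncpoly_eval T (\val a)) /\
  (forall a (e : R), 0 < e ->
     exists2 d : R, 0 < d &
       forall b, (norm_infty (\val b \- \val a)%R < d%:E)%E ->
         (opnorm (Psi b \- Psi a)%R < e%:E)%E).

Definition map_norm Psi : \bar R :=
  ereal_sup [set opnorm (Psi a) |
    a in [set a : disc_algebra R n | (norm_infty (\val a) <= 1)%E]].

Definition map_wnorm (dot : H -> H -> R[i]) Psi : \bar R :=
  ereal_sup [set numerical_radius dot (Psi a) |
    a in [set a : disc_algebra R n | (norm_infty (\val a) <= 1)%E]].

End Calculus.

(* Main.v *)
(** Write [L_j] for the left creation operators. [w_J(T) <= 1] says that the
    form [2 - 2 Re sum_j T_j (x) L_j^*] is nonnegative on finitely supported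
    families [h : word -> H]. Compressing [H] to the span of the vectors
    [T_alpha x] that occur in [p(T) x] makes [H] finite dimensional. The Schur
    complements of the form at the root of the tree of words, averaged over the
    depth of truncation, give (after replacing [T] by [c T], [c < 1]) a positive
    definite [q] with [q + sum_j T_j q^-1 T_j^* <= 2], Ando's description of the
    operators of numerical radius at most 1. As [2 - q <= q^-1 =: P], [T] is a
    row contraction for [P]: its Poisson kernel carries multiplication by [p]
    on the Fock space to [B = p(T)], and for [a = p(0)],
    [A = (B - a) (1 - conj a B)^-1] satisfies [A P A^* <= 2 - q].

    For [y = x - conj a B x] and [v = A y = B x - a x] this gives, with
    [kappa = q(y)], the inequalities [|v|^2 <= 2 kappa] and
    [|<v, y>|^2 <= kappa (2 |y|^2 - kappa)]. Since
    [(1 - |a|^2) x = y + conj a v] and [(1 - |a|^2) B x = v + a y], the bounds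
    [|B x| <= 2 |x|] and [|<B x, x>| <= 5/4 |x|^2] become inequalities between
    real numbers. *)

From HB Require Import structures.
Require Import Defs.
From mathcomp Require Import all_boot all_order all_algebra finmap.
From mathcomp Require Import sesquilinear spectral complex.
From mathcomp Require Import boolp classical_sets.
From mathcomp Require Import cardinality fsbigop reals ereal.
From mathcomp Require Import topology normedtype sequences esum exp.
From mathcomp Require Import ring lra.
From mathcomp Require summability.

Set Implicit Arguments.
Unset Strict Implicit.
Unset Printing Implicit Defensive.

Import Order.TTheory GRing.Theory Num.Theory.
Import numFieldNormedType.Exports.

Local Open Scope ring_scope.

(** * Inequalities between real numbers *)

(** The form [P] may be far from the given norm, so contractivity of [p(T)] for [P] bounds nothing
    by itself. The gain comes from multipliers that vanish at the empty word: paired with the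
    Poisson kernel of [h] they see only its part off the root, whose mass is at most
    [2 |h|^2 - q(h)] and not merely [P(h)]. This is why [p] is composed with the disc automorphism
    that moves [a = p(0)] to [0]. With [a = 0] the constraints give numerical radius at most [1];
    undoing the automorphism raises the bound to [5/4], the worst case being [|a| = 1/2], while for
    the norm bound [2] the worst case is [a = 0]. No limit of operators is taken. Cesaro means
    replace the limit of the Schur complements, kernels are cut off at finite depth, and the inverse
    in the automorphism becomes a partial Neumann series. A factor [c < 1] makes all these errors
    small; it disappears at the end because the evaluated polynomial depends polynomially on [c]. *)

Lemma ler_sqr_lin (R : realDomainType) (x y : R) :
  0 <= y -> x ^+ 2 <= y ^+ 2 -> x <= y.
Proof.
move=> y0 xy; case: (ltP x 0) => [/ltW x0|x0]; first exact: le_trans y0.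
by move: xy; rewrite ler_sqr ?nnegrE.
Qed.

(* For [Y = |y|^2], [m = |A y|^2], [S = |<A y, y>|] the constraints with some
   [kappa] describe the vectors [y] of an operator [A] with [w(A) <= 1]. *)
Lemma ando_cone_ge0 (R : realFieldType) (Y m kappa S a b w : R) :
  0 <= Y -> 0 <= m -> 0 <= kappa -> kappa <= 2 * Y -> 0 <= S -> 0 <= w ->
  S ^+ 2 <= kappa * (2 * Y - kappa) -> S ^+ 2 <= m * Y -> m <= 2 * kappa ->
  0 < a ->
  (0 <= b -> b <= a /\ w <= a + b) ->
  (b < 0 -> w ^+ 2 <= a ^+ 2 + 4 * a * b) ->
  w * S <= a * Y + b * m.
Proof.
move=> Y0 m0 k0 kY S0 w0 Sk SmY mk ap Hp Hn; have a0 := ltW ap.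
have SY : S <= Y.
  apply: ler_sqr_lin => //; apply: le_trans Sk _.
  rewrite -subr_ge0; have -> : Y ^+ 2 - kappa * (2 * Y - kappa) = (Y - kappa) ^+ 2 by ring.
  exact: sqr_ge0.
(* For [b < 0] the worst [m] is [2 * kappa], and the hypothesis on [w ^+ 2] turns the difference of
   squares into a perfect square in [Y] and [kappa]. For [b >= 0] the bounds [S ^+ 2 <= m * Y] and
   [S <= Y] suffice. *)
case: (leP 0 b) => b0.
- have [ba wab] := Hp b0.
  have [Y1|Y1] := eqVneq Y 0.
    have S1 : S = 0 by apply/eqP; rewrite eq_le S0 andbT -Y1.
    by rewrite S1 mulr0 addr_ge0 // mulr_ge0.
  have Yp : 0 < Y by rewrite lt_def Y1.
  rewrite -(ler_pM2r Yp).
  have h1 : b * (S ^+ 2) <= b * (m * Y) by rewrite ler_wpM2l.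
  have h2 : w * (S * Y) <= (a + b) * (S * Y) by rewrite ler_wpM2r // mulr_ge0.
  have h3 : 0 <= (Y - S) * (a * Y - b * S).
    by rewrite mulr_ge0 ?subr_ge0 // ler_pM.
  nra.
- have {}Hn := Hn b0.
  have ab : 0 <= a + 4 * b.
    rewrite -(pmulr_rge0 _ ap); apply: le_trans (sqr_ge0 w) _.
    by apply: le_trans Hn _; rewrite le_eqVlt; apply/orP; left; apply/eqP; ring.
  have E0 : 0 <= a * Y + 2 * b * kappa by nra.
  apply: (@le_trans _ _ (a * Y + 2 * b * kappa)); last by nra.
  apply: ler_sqr_lin => //.
  rewrite exprMn.
  have h1 : w ^+ 2 * S ^+ 2 <= (a ^+ 2 + 4 * a * b) * (kappa * (2 * Y - kappa)).
    by apply: ler_pM => //; exact: sqr_ge0.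
  apply: le_trans h1 _; rewrite -subr_ge0.
  set e := (X in 0 <= X).
  have -> : e = (a * Y - (a + 2 * b) * kappa) ^+ 2 by rewrite /e; ring.
  exact: sqr_ge0.
Qed.

Lemma le_dot2_sqrt (R : rcfType) (x1 x2 y1 y2 : R) :
  x1 * y1 + x2 * y2 <=
  Num.sqrt (x1 ^+ 2 + x2 ^+ 2) * Num.sqrt (y1 ^+ 2 + y2 ^+ 2).
Proof.
have p (u v : R) : 0 <= u ^+ 2 + v ^+ 2 by rewrite addr_ge0 // sqr_ge0.
apply: ler_sqr_lin; first by rewrite mulr_ge0 // sqrtr_ge0.
rewrite exprMn !sqr_sqrtr // -subr_ge0; set e := (X in 0 <= X).
have -> : e = (x1 * y2 - x2 * y1) ^+ 2 by rewrite /e; ring.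
exact: sqr_ge0.
Qed.

(** For [a = a1 + i a2] and vectors with [|y|^2 = Y], [|v|^2 = m], this reads
    [|v + a y| <= 2 |y + conj a v|]. Cauchy-Schwarz on the cross term leaves only [|a|] and the
    modulus [S] of the inner product, which is the situation of [ando_cone_ge0]. *)
Lemma moebius_norm_le (R : rcfType) (Y m kappa a1 a2 s1 s2 : R) :
  0 <= Y -> 0 <= m -> 0 <= kappa -> kappa <= 2 * Y ->
  s1 ^+ 2 + s2 ^+ 2 <= kappa * (2 * Y - kappa) ->
  s1 ^+ 2 + s2 ^+ 2 <= m * Y -> m <= 2 * kappa ->
  a1 ^+ 2 + a2 ^+ 2 <= 1 ->
  m + 2 * (a1 * s1 + a2 * s2) + (a1 ^+ 2 + a2 ^+ 2) * Y <=
  4 * (Y + 2 * (a1 * s1 + a2 * s2) + (a1 ^+ 2 + a2 ^+ 2) * m).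
Proof.
move=> Y0 m0 k0 kY Sk SmY mk t1.
have := le_dot2_sqrt (- a1) (- a2) s1 s2; rewrite !sqrrN.
set S := Num.sqrt (s1 ^+ 2 + s2 ^+ 2); set t := Num.sqrt (a1 ^+ 2 + a2 ^+ 2).
have S2 : S ^+ 2 = s1 ^+ 2 + s2 ^+ 2.
  by rewrite sqr_sqrtr // addr_ge0 // sqr_ge0.
have t2 : t ^+ 2 = a1 ^+ 2 + a2 ^+ 2 by rewrite sqr_sqrtr // addr_ge0 // sqr_ge0.
rewrite -t2; rewrite -t2 in t1; rewrite -S2 in Sk SmY.
have S0 : 0 <= S by rewrite sqrtr_ge0.
have t0 : 0 <= t by rewrite sqrtr_ge0.
have tle : t <= 1 by nra.
move=> hS.
have H : (6 * t) * S <= (4 - t ^+ 2) * Y + (4 * t ^+ 2 - 1) * m.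
  apply: (@ando_cone_ge0 _ _ _ kappa) => //; first by lra.
  - lra.
  - move=> _; split; first lra.
    nra.
  - move=> b0; rewrite -subr_ge0; set e := (X in 0 <= X).
    have -> : e = t ^+ 2 * (24 - 15 * t ^+ 2) by rewrite /e; ring.
    by rewrite mulr_ge0 ?sqr_ge0 //; lra.
nra.
Qed.

(** With the unit number [zeta = c - i d], the left side is the real inner product of
    [zeta (y + conj a v)] with [v + a y], and the right side is [5/4 |y + conj a v|^2]. *)
Lemma moebius_numrange_le (R : rcfType) (Y m kappa a1 a2 s1 s2 c d : R) :
  0 <= Y -> 0 <= m -> 0 <= kappa -> kappa <= 2 * Y ->
  s1 ^+ 2 + s2 ^+ 2 <= kappa * (2 * Y - kappa) ->
  s1 ^+ 2 + s2 ^+ 2 <= m * Y -> m <= 2 * kappa ->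
  a1 ^+ 2 + a2 ^+ 2 <= 1 -> c ^+ 2 + d ^+ 2 = 1 ->
  (c * s1 - d * s2) + (c * a1 - d * a2) * (Y + m) +
  (c * (a1 ^+ 2 - a2 ^+ 2) - d * (2 * a1 * a2)) * s1 +
  (c * (2 * a1 * a2) + d * (a1 ^+ 2 - a2 ^+ 2)) * s2 <=
  5 / 4 * (Y + 2 * (a1 * s1 + a2 * s2) + (a1 ^+ 2 + a2 ^+ 2) * m).
Proof.
move=> Y0 m0 k0 kY Sk SmY mk t1 cd.
set u1 := c + (c * (a1 ^+ 2 - a2 ^+ 2) - d * (2 * a1 * a2)) - 5 / 2 * a1.
set u2 := - d + (c * (2 * a1 * a2) + d * (a1 ^+ 2 - a2 ^+ 2)) - 5 / 2 * a2.
have := le_dot2_sqrt u1 u2 s1 s2.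
set S := Num.sqrt (s1 ^+ 2 + s2 ^+ 2); set w := Num.sqrt (u1 ^+ 2 + u2 ^+ 2).
have S2 : S ^+ 2 = s1 ^+ 2 + s2 ^+ 2.
  by rewrite sqr_sqrtr // addr_ge0 // sqr_ge0.
have w2 : w ^+ 2 = u1 ^+ 2 + u2 ^+ 2 by rewrite sqr_sqrtr // addr_ge0 // sqr_ge0.
rewrite -S2 in Sk SmY.
have S0 : 0 <= S by rewrite sqrtr_ge0.
have w0 : 0 <= w by rewrite sqrtr_ge0.
(* [k + i l = (c + i d) (a1 + i a2)]; as [c + i d] has modulus 1, [w ^+ 2] depends only on [k] and
   on [T = |a|^2]. *)
pose k := c * a1 - d * a2; pose l := c * a2 + d * a1.
set T := a1 ^+ 2 + a2 ^+ 2.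
have T0 : 0 <= T by rewrite addr_ge0 // sqr_ge0.
have kT : k ^+ 2 <= T.
  have -> : T = k ^+ 2 + l ^+ 2.
    have -> : T = (c ^+ 2 + d ^+ 2) * T by rewrite cd mul1r.
    by rewrite /k /l /T; ring.
  by rewrite lerDl sqr_ge0.
rewrite -/T in t1.
have k1 : k <= 1 by nra.
have k1' : -1 <= k by nra.
have w2E : w ^+ 2 = 25 / 4 * T - 5 * k - 5 * T * k + 4 * k ^+ 2 + (1 - T) ^+ 2.
  have -> : w ^+ 2 = (c ^+ 2 + d ^+ 2) * (1 + T ^+ 2) + 4 * k ^+ 2
      - 2 * (c ^+ 2 + d ^+ 2) * T + 25 / 4 * T - 5 * k - 5 * T * k.
    by rewrite w2 /u1 /u2 /T /k; field.
  by rewrite cd; ring.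
move=> hS.
have H : w * S <= (5 / 4 - k) * Y + (5 / 4 * T - k) * m.
  apply: (@ando_cone_ge0 _ _ _ kappa) => //; first by lra.
  - move=> b0; split; first lra.
    apply: ler_sqr_lin; first lra.
    rewrite w2E -subr_ge0; set e := (X in 0 <= X).
    have -> : e = 9 / 16 * (1 - T) ^+ 2 by rewrite /e; field.
    by rewrite mulr_ge0 ?sqr_ge0 //; lra.
  - move=> b0; rewrite w2E -subr_ge0; set e := (X in 0 <= X).
    have -> : e = (k - 1/4) * (k - 9/4) + 2 * T - T ^+ 2 by rewrite /e; field.
    (* Since [k ^+ 2 <= T <= 1], for fixed [k] the worst [T] is [k ^+ 2]. The quartic left there has
       the double root [k = 1/2]: the constant [5/4] is the one for which this case is tangent. *)
    have h1 : 0 <= (k - 1 / 2) ^+ 2 * (9 / 4 - k - k ^+ 2).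
      by rewrite mulr_ge0 ?sqr_ge0 //; lra.
    have h2 : 0 <= (T - k ^+ 2) * (2 - T - k ^+ 2) by rewrite mulr_ge0; lra.
    lra.
rewrite -/k.
have E : u1 * s1 + u2 * s2 + 5 / 2 * (a1 * s1 + a2 * s2) =
    (c * s1 - d * s2) + (c * (a1 ^+ 2 - a2 ^+ 2) - d * (2 * a1 * a2)) * s1 +
    (c * (2 * a1 * a2) + d * (a1 ^+ 2 - a2 ^+ 2)) * s2.
  by rewrite /u1 /u2; field.
lra.
Qed.

(** * Sums over words *)

Section Words.
Variable n : nat.

Fixpoint words (N : nat) : seq (word n) :=
  if N is N'.+1 then
    [::] :: [seq j :: alpha | j <- enum 'I_n, alpha <- words N']
  else [::].

Lemma mem_words N (alpha : word n) : (alpha \in words N) = (size alpha < N)%N.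
Proof.
elim: N alpha => [|N IH] [|j alpha] //=.
rewrite inE /= ltnS -IH; apply/allpairsP/idP => [[[i b] /= [_ ib [_ ->]]] //|jN].
by exists (j, alpha); rewrite /= mem_enum.
Qed.

Lemma uniq_words N : uniq (words N).
Proof.
elim: N => //= N IH; rewrite (allpairs_uniq (enum_uniq _) IH) ?andbT.
  by apply/allpairsP => -[[i b] /= []].
by move=> [i b] [i' b'] _ _ /= [-> ->].
Qed.

Lemma sum_words_cons (V : nmodType) N (f : word n -> V) :
  \sum_(alpha <- words N.+1) f alpha =
  f [::] + \sum_(j < n) \sum_(alpha <- words N) f (j :: alpha).
Proof. by rewrite /= big_cons big_allpairs_dep big_enum. Qed.

(** In Ando's form the children of [alpha] are the words [j :: alpha], so the branch of the tree
    above the vertex [[:: j]] consists of the words that end in [j]. *)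
Lemma sum_words_rcons (V : nmodType) N (f : word n -> V) :
  \sum_(alpha <- words N.+1) f alpha =
  f [::] + \sum_(j < n) \sum_(alpha <- words N) f (rcons alpha j).
Proof.
have rw M (g : word n -> V) :
    \sum_(alpha <- words M) g alpha = \sum_(alpha <- words M) g (rev alpha).
  rewrite -(big_map rev xpredT); apply: perm_big; apply: uniq_perm.
  - exact: uniq_words.
  - by rewrite (map_inj_uniq (can_inj revK)) uniq_words.
  move=> a; rewrite mem_words; apply/idP/mapP => [aM|[b]].
    by exists (rev a); rewrite ?revK // mem_words size_rev.
  by rewrite mem_words => bM ->; rewrite size_rev.
rewrite rw sum_words_cons /=; congr (_ + _); apply: eq_bigr => j _.
rewrite [RHS]rw; apply: eq_bigr => a _.
by rewrite rev_cons.
Qed.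

Lemma sum_words_widen (V : nmodType) N L (f : word n -> V) :
  (N <= L)%N -> (forall alpha, (N <= size alpha)%N -> f alpha = 0) ->
  \sum_(alpha <- words L) f alpha = \sum_(alpha <- words N) f alpha.
Proof.
move=> NL f0; rewrite (bigID (mem (words N))) /= [X in _ + X]big1 ?addr0.
  rewrite -big_filter; apply: perm_big; apply: uniq_perm.
  - by rewrite filter_uniq ?uniq_words.
  - exact: uniq_words.
  move=> a; rewrite mem_filter !mem_words.
  by apply/andP/idP => [[]|aN]; rewrite ?aN //; split=> //; apply: leq_trans NL.
by move=> a; rewrite mem_words -leqNgt; exact: f0.
Qed.

(** A word with a marked cut is the same as a pair of words; [N1 + N2 <= L] ensures that no pair in
    the support is lost. *)
Lemma sum_words_sep (V : nmodType) N1 N2 L (F : word n -> word n -> V) :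
  (N1 + N2 <= L)%N ->
  (forall a b, (N1 <= size a)%N || (N2 <= size b)%N -> F a b = 0) ->
  \sum_(g <- words L) \sum_(k < (size g).+1) F (take k g) (drop k g) =
  \sum_(a <- words N1) \sum_(b <- words N2) F a b.
Proof.
elim: N1 L F => [|N1 IH] L F.
  by move=> _ F0; rewrite big_nil big1 // => g _; rewrite big1 // => k _; rewrite F0.
case: L => // L; rewrite addSn ltnS => NL F0.
rewrite !sum_words_cons big_ord1 /=.
have E (j : 'I_n) : \sum_(g <- words L) \sum_(k < (size g).+2)
      F (take k (j :: g)) (drop k (j :: g)) =
    \sum_(g <- words L) F [::] (j :: g) + \sum_(g <- words L)
      \sum_(k < (size g).+1) F (j :: take k g) (drop k g).
  by rewrite -big_split; apply: eq_bigr => g _; rewrite big_ord_recl.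
rewrite (eq_bigr _ (fun j _ => E j)) big_split /= addrA; congr (_ + _).
  rewrite -(sum_words_cons L (F [::])) (@sum_words_widen _ N2) //.
    by rewrite (leq_trans _ (leqW NL)) // leq_addl.
  by move=> a Na; rewrite F0 // Na orbT.
apply: eq_bigr => j _; rewrite -(IH L (fun a b => F (j :: a) b)) //.
by move=> a b ab; rewrite F0.
Qed.

End Words.

Arguments words : simpl never.

(** * The real inner product of a complex coordinate space *)

Section ComplexRe.
Variable R : rcfType.
Implicit Types z w : R[i].

Lemma complexReD z w : complex.Re (z + w) = complex.Re z + complex.Re w.
Proof. by case: z w => [? ?] [? ?]. Qed.

Lemma complexReN z : complex.Re (- z) = - complex.Re z.
Proof. by case: z. Qed.

Lemma complexRe_sum (I : Type) (r : seq I) (P : pred I) (F : I -> R[i]) :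
  complex.Re (\sum_(i <- r | P i) F i) = \sum_(i <- r | P i) complex.Re (F i).
Proof. exact: (big_morph _ complexReD erefl). Qed.

Lemma complexRe_conj z : complex.Re z^* = complex.Re z.
Proof. by case: z. Qed.

Lemma complexRe_realM (c : R) z : complex.Re (c%:C%C * z) = c * complex.Re z.
Proof. by case: z => a b /=; rewrite mul0r subr0. Qed.

Lemma conj_real (c : R) : (c%:C%C)^* = c%:C%C :> R[i].
Proof. exact: conjc_real. Qed.

Lemma Re_mul_conj_ge0 z : 0 <= complex.Re (z^* * z).
Proof. by case: z => a b /=; rewrite mulNr opprK addr_ge0 // -expr2 sqr_ge0. Qed.

End ComplexRe.

Local Notation "A ^t*" := ((A ^T) ^ Num.conj)%sesqui : ring_scope.

Section RealInnerProduct.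
Variables (R : rcfType).

(** Keeping only the real part makes the pairing symmetric and bilinear over the reals. The
    imaginary part is recovered by pairing with ['i *: x], see [rdotZlE]. *)
Definition rdot k (x y : 'cV[R[i]]_k) : R :=
  complex.Re (\sum_(i < k) (x i 0)^* * y i 0).

Definition qf k (A : 'M[R[i]]_k) (x : 'cV[R[i]]_k) : R := rdot x (A *m x).

Section Fixed.
Variable k : nat.
Implicit Types (x y u w : 'cV[R[i]]_k) (A q : 'M[R[i]]_k).

Lemma rdotC x y : rdot x y = rdot y x.
Proof.
rewrite /rdot -complexRe_conj rmorph_sum; congr complex.Re; apply: eq_bigr => i _.
by rewrite rmorphM /= conjCK mulrC.
Qed.

Lemma rdotDr x y w : rdot x (y + w) = rdot x y + rdot x w.
Proof.
by rewrite /rdot -complexReD -big_split; congr complex.Re; apply: eq_bigr => i _;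
   rewrite mxE mulrDr.
Qed.

Lemma rdotDl x y w : rdot (y + w) x = rdot y x + rdot w x.
Proof. by rewrite rdotC rdotDr !(rdotC x). Qed.

Lemma rdotNr x y : rdot x (- y) = - rdot x y.
Proof.
by rewrite /rdot -complexReN -sumrN; congr complex.Re; apply: eq_bigr => i _;
   rewrite mxE mulrN.
Qed.

Lemma rdotNl x y : rdot (- y) x = - rdot y x.
Proof. by rewrite rdotC rdotNr rdotC. Qed.

Lemma rdotBr x y w : rdot x (y - w) = rdot x y - rdot x w.
Proof. by rewrite rdotDr rdotNr. Qed.

Lemma rdotBl x y w : rdot (y - w) x = rdot y x - rdot w x.
Proof. by rewrite rdotDl rdotNl. Qed.

Lemma rdot0r x : rdot x 0 = 0.
Proof. by rewrite -(subrr 0) rdotBr subrr. Qed.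

Lemma rdot_sumr (I : Type) (r : seq I) (F : I -> 'cV[R[i]]_k) x :
  rdot x (\sum_(i <- r) F i) = \sum_(i <- r) rdot x (F i).
Proof. exact: (big_morph _ (rdotDr x) (rdot0r x)). Qed.

Lemma rdot_suml (I : Type) (r : seq I) (F : I -> 'cV[R[i]]_k) x :
  rdot (\sum_(i <- r) F i) x = \sum_(i <- r) rdot (F i) x.
Proof. by rewrite rdotC rdot_sumr; apply: eq_bigr => i _; rewrite rdotC. Qed.

Lemma rdotZZ (a : R[i]) x y : rdot (a *: x) y = rdot x (a^* *: y).
Proof.
congr complex.Re; apply: eq_bigr => i _; rewrite !mxE rmorphM.
by rewrite [in LHS](mulrC (a^*)) mulrA.
Qed.

Lemma rdotZr (c : R) x y : rdot x (c%:C%C *: y) = c * rdot x y.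
Proof.
rewrite /rdot -complexRe_realM mulr_sumr; congr complex.Re; apply: eq_bigr => i _.
by rewrite mxE mulrCA.
Qed.

Lemma rdotZl (c : R) x y : rdot (c%:C%C *: x) y = c * rdot x y.
Proof. by rewrite rdotC rdotZr rdotC. Qed.

Lemma rdot_ge0 x : 0 <= rdot x x.
Proof. by rewrite /rdot complexRe_sum sumr_ge0 // => i _; exact: Re_mul_conj_ge0. Qed.

Lemma rdot_eq0 x : rdot x x = 0 -> x = 0.
Proof.
rewrite /rdot complexRe_sum => /eqP; rewrite psumr_eq0; last first.
  by move=> i _; exact: Re_mul_conj_ge0.
move=> /allP h; apply/matrixP => i j; rewrite ord1 mxE.
have := h i (mem_index_enum _) => /=; case: (x i 0) => a b /=.
rewrite mulNr opprK -!expr2 paddr_eq0 ?sqr_ge0 // !sqrf_eq0.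
by move=> /andP[/eqP-> /eqP->].
Qed.

Lemma rdotZ_norm (a : R[i]) x :
  rdot (a *: x) (a *: x) = complex.Re (a^* * a) * rdot x x.
Proof.
rewrite /rdot; set s := \sum_i _; set t := \sum_i _.
have -> : s = (a^* * a) * t.
  by rewrite mulr_sumr; apply: eq_bigr => i _; rewrite !mxE rmorphM; ring.
case: a t {s} => a b [c d] /=; ring.
Qed.

Lemma rdot_adj l (A : 'M[R[i]]_(l, k)) (z : 'cV[R[i]]_l) y :
  rdot (A^t* *m z) y = rdot z (A *m y).
Proof.
congr complex.Re.
under eq_bigr do rewrite !mxE rmorph_sum mulr_suml.
under [RHS]eq_bigr do rewrite !mxE mulr_sumr.
rewrite exchange_big; apply: eq_bigr => i _; apply: eq_bigr => j _.
rewrite !mxE rmorphM /= conjCK.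
by have cA (a b c : R[i]) : a * b * c = b * (a * c) by ring; exact: cA.
Qed.

Lemma adjK l (A : 'M[R[i]]_(l, k)) : (A^t*)^t* = A.
Proof.
by apply/matrixP => i j; rewrite !mxE conjCK.
Qed.

Lemma qfZ (c : R) A x : qf (c%:C%C *: A) x = c * qf A x.
Proof. by rewrite /qf -scalemxAl rdotZr. Qed.

Lemma qfB A q x : qf (A - q) x = qf A x - qf q x.
Proof. by rewrite /qf mulmxBl rdotBr. Qed.

Lemma qf_sum (I : Type) (r : seq I) (F : I -> 'M[R[i]]_k) x :
  qf (\sum_(i <- r) F i) x = \sum_(i <- r) qf (F i) x.
Proof. by rewrite /qf mulmx_suml rdot_sumr. Qed.

Lemma qf_scalar (c : R) x : qf (c%:C%C%:M) x = c * rdot x x.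
Proof. by rewrite /qf mul_scalar_mx rdotZr. Qed.

Lemma qf_scale (c : R) A x : qf A (c%:C%C *: x) = c ^+ 2 * qf A x.
Proof. by rewrite /qf -scalemxAr rdotZl rdotZr expr2 mulrA. Qed.

Section PositiveDefinite.
Variables (q : 'M[R[i]]_k) (e : R).
Hypotheses (qH : q^t* = q) (e0 : 0 < e)
  (qe : forall x, e * rdot x x <= qf q x).

Lemma posdef_unit : q \in unitmx.
Proof.
rewrite -row_free_unit -kermx_eq0; apply/eqP/row_matrixP => i; rewrite row0.
set u := row i _; have uq : u *m q = 0 by rewrite -row_mul mulmx_ker row0.
have q0 : q *m u^t* = 0.
  by rewrite -qH -[LHS]/(_ *m _) -map_mxM -trmx_mul uq trmx0 map_mx0.
have u0 : u^t* = 0.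
  apply: rdot_eq0; apply/eqP; rewrite eq_le rdot_ge0 andbT -(pmulr_rle0 _ e0).
  by apply: le_trans (qe _) _; rewrite /qf q0 rdot0r.
have := congr1 (fun A : 'cV_k => (A^T) ^ Num.conj)%sesqui u0.
by rewrite adjK => ->; rewrite trmx0 map_mx0.
Qed.

Lemma posdef_ge0 x : 0 <= qf q x.
Proof. by apply: le_trans (qe x); rewrite mulr_ge0 ?rdot_ge0 // ltW. Qed.

Lemma invmx_adj : (invmx q)^t* = invmx q.
Proof. by rewrite trmx_inv map_invmx qH. Qed.

Lemma qf_inv x : qf (invmx q) x = qf q (invmx q *m x).
Proof.
by rewrite /qf [in RHS]mulmxA (mulmxV posdef_unit) mul1mx rdotC.
Qed.

Lemma qf_inv_ge0 x : 0 <= qf (invmx q) x.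
Proof. by rewrite qf_inv posdef_ge0. Qed.

(** Expansion of [0 <= qf q (w - invmx q *m u)]: the Fenchel-Young inequality between [q] and its
    dual form. *)
Lemma young_inv u w : 2 * rdot u w <= qf (invmx q) u + qf q w.
Proof.
have := posdef_ge0 (w - invmx q *m u).
rewrite {1}/qf mulmxBr mulmxA (mulmxV posdef_unit) mul1mx rdotBr !rdotBl.
rewrite -[rdot w (q *m w)]/(qf q w) (rdotC w u).
have -> : rdot (invmx q *m u) (q *m w) = rdot u w.
  by rewrite -{1}invmx_adj rdot_adj mulmxA (mulVmx posdef_unit) mul1mx.
have -> : rdot (invmx q *m u) u = qf (invmx q) u by rewrite rdotC.
by move=> ?; lra.
Qed.

End PositiveDefinite.
End Fixed.
End RealInnerProduct.

(** * Ando's form *)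

Section AndoForm.
Variables (R : realType) (n k : nat).
Implicit Types (T : 'I_n -> 'M[R[i]]_k) (h : word n -> 'cV[R[i]]_k).

Definition numrange_le T (r : R) := forall N h,
  (forall alpha, (N <= size alpha)%N -> h alpha = 0) ->
  \sum_(alpha <- words n N) \sum_j rdot (h alpha) (T j *m h (j :: alpha)) <=
  r * \sum_(alpha <- words n N) rdot (h alpha) (h alpha).

(* Schur complements of the truncations of [2 - 2 Re (sum_j T_j (x) L_j^* )]
   at the root of the tree of words. *)
Fixpoint schur T (m : nat) : 'M[R[i]]_k :=
  if m is m'.+1 then
    2%:C%C%:M - \sum_j T j *m invmx (schur T m') *m (T j)^t*
  else 2%:C%C%:M.

(** The three claims need a common induction: the third exhibits [schur T m] as a value of the form,
    this value is bounded below by the second, and the lower bound makes [schur T m] invertible, so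
    that the next Schur complement is a genuine one. *)
Lemma schur_spec T r m : r < 1 -> numrange_le T r ->
  [/\ (schur T m)^t* = schur T m,
      forall x, (2 - 2 * r) * rdot x x <= qf (schur T m) x &
      forall x, exists h,
        [/\ forall alpha, (m < size alpha)%N -> h alpha = 0, h [::] = x &
         \sum_(alpha <- words n m.+1) (2 * rdot (h alpha) (h alpha) -
            2 * \sum_j rdot (h alpha) (T j *m h (j :: alpha))) =
         qf (schur T m) x]].
Proof.
move=> r1 Tr.
have low m' q : (forall x, exists h,
        [/\ forall alpha, (m' < size alpha)%N -> h alpha = 0, h [::] = x &
         \sum_(alpha <- words n m'.+1) (2 * rdot (h alpha) (h alpha) -
            2 * \sum_j rdot (h alpha) (T j *m h (j :: alpha))) = qf q x]) ->
    forall x, (2 - 2 * r) * rdot x x <= qf q x.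
  move=> H x; have [h [h0 hx <-]] := H x.
  rewrite big_split /= -mulr_sumr sumrN -mulr_sumr.
  have := Tr m'.+1 h h0.
  set S := \sum_(a <- _) rdot _ _; set X := \sum_(a <- _) \sum_j _ => XS.
  have : rdot x x <= S.
    rewrite /S sum_words_cons hx lerDl sumr_ge0 // => j _.
    by apply: sumr_ge0 => a _; exact: rdot_ge0.
  by move=> xS; nra.
elim: m => [|m [IH1 IH2 IH3]].
  have H x : exists h,
        [/\ forall alpha, (0 < size alpha)%N -> h alpha = 0, h [::] = x &
         \sum_(alpha <- words n 1) (2 * rdot (h alpha) (h alpha) -
            2 * \sum_j rdot (h alpha) (T j *m h (j :: alpha))) =
         qf (schur T 0) x].
    exists (fun a => if a is [::] then x else 0); split=> //; first by case.
    rewrite sum_words_cons /= big1; last by move=> j _; rewrite mulmx0 rdot0r.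
    rewrite big1; last by move=> j _; rewrite big_nil.
    by rewrite qf_scalar mulr0 subr0 addr0.
  split=> //; last exact: low.
  by rewrite /= tr_scalar_mx map_scalar_mx /= conj_real.
have e0 : 0 < 2 - 2 * r by lra.
set P := invmx (schur T m).
have PH : P^t* = P by exact: invmx_adj.
have H x : exists h,
        [/\ forall alpha, (m.+1 < size alpha)%N -> h alpha = 0, h [::] = x &
         \sum_(alpha <- words n m.+2) (2 * rdot (h alpha) (h alpha) -
            2 * \sum_j rdot (h alpha) (T j *m h (j :: alpha))) =
         qf (schur T m.+1) x].
  (* The vector [P *m ((T j)^t* *m x)] minimizes [qf (schur T m) z - 2 * rdot x (T j *m z)] over
     [z], so it is the optimal value of [h] at the foot of the branch [j]. *)
  have /boolp.choice[f fP] := fun j => IH3 (P *m ((T j)^t* *m x)).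
  pose h (a : word n) := if rev a is j :: b then f j (rev b) else x.
  have hr a j : h (rcons a j) = f j a by rewrite /h rev_rcons revK.
  exists h; split=> //.
    case/lastP => // a j; rewrite size_rcons ltnS hr => sa.
    by have [f0 _ _] := fP j; exact: f0.
  rewrite sum_words_rcons.
  have E j : \sum_(a <- words n m.+1) (2 * rdot (h (rcons a j)) (h (rcons a j)) -
         2 * \sum_j0 rdot (h (rcons a j)) (T j0 *m h (j0 :: rcons a j))) =
      qf P ((T j)^t* *m x).
    have [_ _] := fP j; rewrite -(qf_inv IH1 e0 IH2) => <-.
    by apply: eq_bigr => a _; rewrite hr; congr (_ - _ * _); apply: eq_bigr => i _;
      rewrite -rcons_cons hr.
  rewrite (eq_bigr _ (fun j _ => E j)) /= qfB qf_scalar qf_sum.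
  have -> : \sum_j rdot (h [::]) (T j *m h [:: j]) = \sum_j qf P ((T j)^t* *m x).
    apply: eq_bigr => j _; rewrite -[ [:: j] ]/(rcons [::] j) hr.
    by have [_ -> _] := fP j; rewrite /qf rdot_adj.
  have -> : \sum_j qf (T j *m P *m (T j)^t*) x = \sum_j qf P ((T j)^t* *m x).
    by apply: eq_bigr => j _; rewrite /qf rdot_adj !mulmxA.
  by rewrite -/(h [::]); ring.
split=> //; last exact: low.
rewrite /= -/P [in LHS]linearB /= map_mxB tr_scalar_mx map_scalar_mx /= conj_real.
congr (_ - _); rewrite linear_sum /= map_mx_sum; apply: eq_bigr => j _.
by rewrite !trmx_mul !map_mxM PH adjK mulmxA.
Qed.

(** Young's inequality trades the inverse in the recursion for an inequality that is affine in
    [schur T m.+1] and [schur T m], and therefore survives averaging over [m]. *)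
Lemma schur_step T r m x (z : 'I_n -> 'cV_k) : r < 1 -> numrange_le T r ->
  qf (schur T m.+1) x + 2 * \sum_j rdot x (T j *m z j) <=
  2 * rdot x x + \sum_j qf (schur T m) (z j).
Proof.
move=> r1 Tr; have [H1 H2 _] := schur_spec m r1 Tr.
have e0 : 0 < 2 - 2 * r by lra.
rewrite /= qfB qf_scalar qf_sum -addrA lerD2l addrC lerBlDr -big_split /=.
rewrite mulr_sumr; apply: ler_sum => j _; rewrite -rdot_adj.
have -> : qf (T j *m invmx (schur T m) *m (T j)^t*) x =
          qf (invmx (schur T m)) ((T j)^t* *m x) by rewrite /qf rdot_adj !mulmxA.
by rewrite addrC; exact: (young_inv H1 e0 H2).
Qed.

(** A fixed point of the Schur recursion would do. A mean of [L] consecutive Schur complements is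
    one up to a telescoping error of order [1 / L], which the gap between [c] and 1 absorbs. *)
Lemma ando_form T (c : R) : 0 <= c -> c < 1 -> numrange_le T 1 ->
  exists (q : 'M[R[i]]_k) (e : R),
  [/\ q^t* = q, 0 < e, (forall x, e * rdot x x <= qf q x) &
   forall x (z : 'I_n -> 'cV_k),
     2 * c * \sum_j rdot x (T j *m z j) <=
     2 * rdot x x - qf q x + \sum_j qf q (z j)].
Proof.
move=> c0 c1 T1.
have [L L0 cL] : exists2 L : nat, (0 < L)%N & c * (1 + L%:R^-1) < 1.
  exists (Num.bound (c / (1 - c))).+1 => //.
  have c1' : 0 <= 1 - c by lra.
  have := archi_boundP (divr_ge0 c0 c1').
  set M := Num.bound _ => cM.
  have M0 : 0 < M.+1%:R :> R by rewrite ltr0n.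
  have : c / (1 - c) < M.+1%:R by apply: lt_trans cM _; rewrite ltr_nat.
  rewrite ltr_pdivrMr ?subr_gt0 // => h.
  by rewrite -(ltr_pM2r M0) mul1r -mulrA mulrDl mul1r mulVf ?lt0r_neq0 //; lra.
have LL : 0 < L%:R :> R by rewrite ltr0n.
set l := 1 + L%:R^-1 in cL.
have l0 : 0 < l by rewrite addr_gt0 // invr_gt0.
set r := c * l in cL.
have r0 : 0 <= r by rewrite mulr_ge0 // ltW.
pose T' j := r%:C%C *: T j.
have Tr : numrange_le T' r.
  move=> N h h0; have := T1 N h h0; rewrite mul1r => /(ler_wpM2l r0).
  apply: le_trans; rewrite le_eqVlt; apply/orP; left; apply/eqP.
  rewrite mulr_sumr; apply: eq_bigr => a _; rewrite mulr_sumr.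
  by apply: eq_bigr => j _; rewrite -scalemxAl rdotZr.
have S m := schur_spec m cL Tr.
(* Here [l * L = L + 1]: the telescoped sum has an extra [2 |x|^2] on the right, and dividing by
   [L + 1] instead of [L] absorbs it while lowering [r = c * l] to [c]. *)
pose b : R := (l * L%:R)^-1.
have b0 : 0 < b by rewrite invr_gt0 mulr_gt0.
have qE x : qf (b%:C%C *: \sum_(m < L) schur T' m) x =
    b * \sum_(m < L) qf (schur T' m) x by rewrite qfZ qf_sum.
exists (b%:C%C *: \sum_(m < L) schur T' m), (b * (2 - 2 * r) * L%:R); split.
- rewrite linearZ map_mxZ /= conj_real linear_sum map_mx_sum; congr (_ *: _).
  by apply: eq_bigr => m _; have [] := S m.
- by rewrite !mulr_gt0 // subr_gt0; lra.
- move=> x; rewrite qE -!mulrA ler_pM2l // mulrCA.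
  have -> : L%:R * ((2 - 2 * r) * rdot x x) = \sum_(m < L) (2 - 2 * r) * rdot x x.
    by rewrite sumr_const card_ord mulr_natl.
  apply: ler_sum => m _.
  by have [_ + _] := S m; apply.
move=> x z; rewrite qE (eq_bigr _ (fun j _ => qE (z j))) -mulr_sumr.
have : \sum_(m < L) (qf (schur T' m.+1) x + 2 * r * \sum_j rdot x (T j *m z j)) <=
    \sum_(m < L) (2 * rdot x x + \sum_j qf (schur T' m) (z j)).
  apply: ler_sum => m _; have := schur_step m x z cL Tr.
  by rewrite -mulrA [r * _]mulr_sumr; under eq_bigr do rewrite -scalemxAl rdotZr.
have scst (y : R) : \sum_(m < L) y = L%:R * y.
  by rewrite sumr_const card_ord mulr_natl.
rewrite !big_split /= !scst exchange_big /=.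
have -> : \sum_(m < L) qf (schur T' m.+1) x =
   \sum_(m < L) qf (schur T' m) x + qf (schur T' L) x - 2 * rdot x x.
  pose f m := qf (schur T' m) x.
  have := @big_ord_recr _ 0 +%R L (fun m => f m); rewrite big_ord_recl /=.
  rewrite {1}/f /= qf_scalar => E.
  apply: (addrI (2 * rdot x x)); rewrite [LHS]E /f.
  by rewrite [RHS]addrC subrK.
have sL : 0 <= qf (schur T' L) x.
  have [_ + _] := S L => /(_ x); apply: le_trans.
  by rewrite mulr_ge0 ?rdot_ge0 //; lra.
set A := \sum_(m < L) qf _ x; set B := \sum_i \sum_j _; set X := \sum_j rdot _ _.
move=> H; rewrite -(ler_pM2l (mulr_gt0 l0 LL)).
have bE : l * L%:R * b = 1 by rewrite mulfV // lt0r_neq0 // mulr_gt0.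
have E1 : l * L%:R * (2 * c * X) = L%:R * (2 * r * X) by rewrite /r; ring.
have E2 : l * L%:R * (2 * rdot x x - b * A + b * B) =
   2 * (L%:R + 1) * rdot x x - A + B.
  have lL : l * L%:R = L%:R + 1 by rewrite /l mulrDl mul1r mulVf // lt0r_neq0.
  rewrite mulrDr mulrBr !(mulrA (l * L%:R) b) bE !mul1r lL; ring.
rewrite E1 E2; lra.
Qed.

End AndoForm.

(** * Factorization of positive semidefinite matrices *)

Section Factorization.
Variables (R : rcfType) (k : nat).

Lemma psd_factor (M : 'M[R[i]]_k) :
  M^t* = M -> (forall x, 0 <= qf M x) -> exists Y : 'M[R[i]]_k, Y^t* *m Y = M.
Proof.
move=> MH M0.
have Mn : M \is normalmx by apply/normalmxP; rewrite MH.
have /orthomx_spectralP := Mn.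
set U := spectralmx M; set d := spectral_diag M => ME.
have Uu : U \is unitarymx by exact: spectral_unitarymx.
rewrite invmx_unitary // in ME.
have UU : U *m U^t* = 1%:M by apply/unitarymxP.
have dE : diag_mx d = U *m M *m U^t*.
  by rewrite [in RHS]ME !mulmxA UU mul1mx -mulmxA UU mulmx1.
have d_real i : d 0 i = (complex.Re (d 0 i))%:C%C /\ 0 <= complex.Re (d 0 i).
  have dH : (diag_mx d)^t* = diag_mx d.
    by rewrite dE !trmx_mul !map_mxM adjK MH mulmxA.
  have := congr1 (fun A : 'M_k => A i i) dH; rewrite !mxE eqxx mulr1n => dc.
  (* The columns of [U^t*] are eigenvectors of [M]; testing [M] on the [i]-th one gives the sign of
     the eigenvalue. *)
  have := M0 (U^t* *m delta_mx i 0).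
  rewrite /qf rdot_adj !mulmxA -dE mul_diag_mx /rdot (bigD1 i) //= big1 => [|j ji].
    rewrite !mxE !eqxx mulr1 rmorph1 mul1r addr0; split=> //.
    by move: dc; case: (d 0 i) => a b [/eqP]; rewrite -subr_eq0 -opprD oppr_eq0;
      rewrite -mulr2n mulrn_eq0 /= => /eqP ->.
  by rewrite !mxE (negPf ji) /= rmorph0 mul0r.
exists (diag_mx (map_mx (fun z => (Num.sqrt (complex.Re z))%:C%C) d) *m U).
rewrite trmx_mul map_mxM tr_diag_mx map_diag_mx mulmxA -[U^t* *m _ *m _]mulmxA mulmx_diag.
rewrite [RHS]ME; congr (_ *m _ *m _).
apply/matrixP => i j; rewrite !mxE; case: eqP => // _; rewrite !mulr1n.
have [di d0] := d_real i.
by rewrite /= conj_real -rmorphM -expr2 sqr_sqrtr.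
Qed.

End Factorization.

(** * Multipliers of the vector-valued Fock space *)

Lemma exp_small (R : realType) (r e : R) :
  0 <= r -> r < 1 -> 0 < e -> exists N, r ^+ N <= e.
Proof.
move=> r0 r1 e0; have rn : `|r| < 1 by rewrite ger0_norm.
have /cvgrPdist_le/(_ e e0)[N _ /(_ N (leqnn N))] := cvg_expr rn.
by rewrite /= sub0r normrN ger0_norm ?exprn_ge0 // => ?; exists N.
Qed.

Section Tensor.
Variables (R : realType) (n k : nat).
Implicit Types (p : word n -> R[i]) (psi chi : word n -> 'cV[R[i]]_k).

Definition nsq N psi : R := \sum_(alpha <- words n N) rdot (psi alpha) (psi alpha).

Definition supp V N (f : word n -> V : nmodType) : Prop :=
  forall alpha, (N <= size alpha)%N -> f alpha = 0.

Definition vtensor p psi : word n -> 'cV[R[i]]_k := fun gamma =>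
  \sum_(l < (size gamma).+1) p (take l gamma) *: psi (drop l gamma).

Lemma vtensor_supp p psi D N :
  supp D p -> supp N psi -> supp (N + D) (vtensor p psi).
Proof.
move=> pD psiN a Na; apply: big1 => l _.
case: (leqP D l) => Dl.
  rewrite pD ?scale0r // size_takel //; by rewrite -ltnS.
rewrite psiN ?scaler0 // size_drop.
have la : (l <= size a)%N by rewrite -ltnS.
by rewrite leq_subRL // (leq_trans _ Na) // addnC leq_add2l ltnW.
Qed.

Lemma vtensor_sum p (I : Type) (r : seq I) (F : I -> word n -> 'cV[R[i]]_k) a :
  vtensor p (fun b => \sum_(i <- r) F i b) a = \sum_(i <- r) vtensor p (F i) a.
Proof.
by rewrite exchange_big; apply: eq_bigr => l _; rewrite scaler_sumr.
Qed.

Lemma vtensor_nil p psi : vtensor p psi [::] = p [::] *: psi [::].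
Proof. by rewrite /vtensor big_ord1. Qed.

Lemma nsq_widen N L psi : (N <= L)%N -> supp N psi -> nsq L psi = nsq N psi.
Proof.
by move=> NL psiN; apply: sum_words_widen => // a Na; rewrite psiN // rdot0r.
Qed.

Lemma nsq_ge0 N psi : 0 <= nsq N psi.
Proof. by apply: sumr_ge0 => a _; exact: rdot_ge0. Qed.

Lemma nsqZ N (c : R[i]) psi :
  nsq N (fun a => c *: psi a) = complex.Re (c^* * c) * nsq N psi.
Proof. by rewrite /nsq mulr_sumr; apply: eq_bigr => a _; rewrite rdotZ_norm. Qed.

(** The squared triangle inequality with a parameter in place of square roots; [t = |chi| / |psi|]
    is the optimal choice. *)
Lemma nsq_sub_le N (t : R) psi chi : 0 < t ->
  nsq N (fun a => psi a - chi a) <=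
  (1 + t) * nsq N psi + (1 + t^-1) * nsq N chi.
Proof.
move=> t0; rewrite /nsq !mulr_sumr -big_split /=; apply: ler_sum => a _.
set x := psi a; set y := chi a.
have := rdot_ge0 (t%:C%C *: x + y).
rewrite !rdotDl !rdotDr !rdotZl !rdotZr !rdotNl !rdotNr (rdotC y x) => h.
rewrite -(ler_pM2l t0).
have -> : t * ((1 + t) * rdot x x + (1 + t^-1) * rdot y y) =
  t * (1 + t) * rdot x x + (t + 1) * rdot y y.
  by field; rewrite gt_eqF.
nra.
Qed.

Lemma sum_rdot_le (r : seq (word n)) (t : R) psi chi : 0 < t ->
  2 * \sum_(a <- r) rdot (psi a) (chi a) <=
  t * \sum_(a <- r) rdot (psi a) (psi a) +
  t^-1 * \sum_(a <- r) rdot (chi a) (chi a).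
Proof.
move=> t0; rewrite !mulr_sumr -big_split /=; apply: ler_sum => a _.
set x := psi a; set y := chi a.
have := rdot_ge0 (t%:C%C *: x - y).
rewrite !rdotBl !rdotBr !rdotZl !rdotZr (rdotC y x) => h.
rewrite -(ler_pM2l t0).
have -> : t * (t * rdot x x + t^-1 * rdot y y) = t * (t * rdot x x) + rdot y y.
  by field; rewrite gt_eqF.
lra.
Qed.

(* [|f - a g|^2 - |g - conj a f|^2 = (1 - |a|^2) (|f|^2 - |g|^2)]. *)
Lemma nsq_moebius N (a : R[i]) f g :
  complex.Re (a^* * a) <= 1 -> nsq N f <= nsq N g ->
  nsq N (fun b => f b - a *: g b) <= nsq N (fun b => g b - a^* *: f b).
Proof.
move=> a1 fg; set A := complex.Re _ in a1.
have E : nsq N (fun b => f b - a *: g b) - nsq N (fun b => g b - a^* *: f b) =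
         (1 - A) * (nsq N f - nsq N g).
  rewrite /nsq -!sumrB mulr_sumr; apply: eq_bigr => b _.
  rewrite !rdotBl !rdotBr !rdotZ_norm conjCK (mulrC a) -/A.
  by rewrite (rdotC (f b)) !(rdotZZ a) (rdotC (a^* *: f b)); ring.
by rewrite -subr_le0 E mulr_ge0_le0 ?subr_ge0 ?subr_le0.
Qed.

End Tensor.

(** * The von Neumann inequality for Ando's form *)

Lemma telescope_ord (V : zmodType) (f : nat -> V) M :
  \sum_(m < M) (f m - f m.+1) = f 0 - f M.
Proof.
elim: M => [|M IH]; first by rewrite big_ord0 subrr.
by rewrite big_ord_recr /= IH addrA subrK.
Qed.

Section Poisson.
Variables (R : realType) (n k : nat).
Implicit Types (b x y h : 'cV[R[i]]_k) (phi psi : word n -> 'cV[R[i]]_k).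
Implicit Types (p : word n -> R[i]).

Definition word_mx (S : 'I_n -> 'M[R[i]]_k) (alpha : word n) : 'M[R[i]]_k :=
  foldr (fun j A => S j *m A) 1%:M alpha.

Definition poly_mx (S : 'I_n -> 'M[R[i]]_k) p D : 'M[R[i]]_k :=
  \sum_(alpha <- words n D) p alpha *: word_mx S alpha.

Lemma word_mx_cat S (a b : word n) : word_mx S (a ++ b) = word_mx S a *m word_mx S b.
Proof. by elim: a => [|j a IH] /=; rewrite ?mul1mx // IH mulmxA. Qed.

Definition contractive p := forall N phi, supp N phi ->
  forall L, nsq L (vtensor p phi) <= nsq N phi.

Variables (S : 'I_n -> 'M[R[i]]_k) (q : 'M[R[i]]_k) (e rho : R).
Hypotheses (qH : q^t* = q) (e0 : 0 < e) (qe : forall x, e * rdot x x <= qf q x).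
Hypotheses (rho0 : 0 < rho) (rho1 : rho < 1).
Let P := invmx q.
Hypothesis Sq : forall b,
  \sum_j qf P ((S j)^t* *m b) <= rho * (2 * rdot b b - qf q b).

Let P_ge0 b : 0 <= qf P b. Proof. exact: qf_inv_ge0 qH e0 qe b. Qed.
Let Pyoung u w : 2 * rdot u w <= qf P u + qf q w.
Proof. exact: young_inv qH e0 qe u w. Qed.
Let r b := 2 * rdot b b - qf q b.
(** Young's inequality with both vectors equal to [b]. It turns [Sq] into a strict row contraction
    for [P], while [Sq] itself keeps the sharper bound by [r]. *)
Let r_le b : r b <= qf P b.
Proof. by rewrite lerBlDr Pyoung. Qed.
Let SP_ge0 b : 0 <= \sum_j qf P ((S j)^t* *m b).
Proof. by apply: sumr_ge0 => j _; exact: P_ge0. Qed.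
Let r_ge0 b : 0 <= r b.
Proof.
by rewrite -(pmulr_rge0 _ rho0); exact: le_trans (SP_ge0 b) (Sq b).
Qed.
Let SP_le_r b : \sum_j qf P ((S j)^t* *m b) <= r b.
Proof. by apply: le_trans (Sq b) _; rewrite ler_piMl ?r_ge0 // ltW. Qed.
Let SP_le_P b : \sum_j qf P ((S j)^t* *m b) <= rho * qf P b.
Proof. by apply: le_trans (Sq b) _; rewrite ler_pM2l // r_le. Qed.

(** [Y] is a defect operator of the row contraction. The identity [YE] is one level of the energy
    balance that is summed along the tree of words below. *)
Let exists_defect : exists Y : 'M[R[i]]_k,
  Y^t* *m Y = P - \sum_j S j *m P *m (S j)^t*.
Proof.
have PH : P^t* = P by exact: invmx_adj.
apply: psd_factor.
  rewrite [in LHS]linearB /= map_mxB PH; congr (_ - _).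
  rewrite linear_sum /= map_mx_sum; apply: eq_bigr => j _.
  by rewrite !trmx_mul !map_mxM PH adjK mulmxA.
move=> x; rewrite qfB qf_sum subr_ge0.
have -> : \sum_j qf (S j *m P *m (S j)^t*) x = \sum_j qf P ((S j)^t* *m x).
  by apply: eq_bigr => j _; rewrite /qf rdot_adj !mulmxA.
by apply: le_trans (SP_le_P x) _; rewrite ler_piMl ?P_ge0 // ltW.
Qed.

Let Y := projT1 (boolp.cid exists_defect).
Let YE b : qf P b = rdot (Y *m b) (Y *m b) + \sum_j qf P ((S j)^t* *m b).
Proof.
rewrite -rdot_adj mulmxA /Y; case: (boolp.cid _) => /= Z ->.
rewrite rdotC -/(qf _ b) qfB qf_sum.
have -> : \sum_j qf (S j *m P *m (S j)^t*) b = \sum_j qf P ((S j)^t* *m b).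
  by apply: eq_bigr => j _; rewrite /qf rdot_adj !mulmxA.
by rewrite subrK.
Qed.

(* The Poisson kernel of the strict row contraction [S] for the norm dual
   to [q]; [lift] is its adjoint. *)
Let poisson b (alpha : word n) := Y *m ((word_mx S alpha)^t* *m b).
Let lift N phi := \sum_(alpha <- words n N) word_mx S alpha *m (Y^t* *m phi alpha).

Let poisson_cons b j alpha : poisson b (j :: alpha) = poisson ((S j)^t* *m b) alpha.
Proof. by rewrite /poisson /= trmx_mul map_mxM !mulmxA. Qed.

Let poisson_nil b : poisson b [::] = Y *m b.
Proof. by rewrite /poisson /= trmx1 map_mx1 mul1mx. Qed.

Let poisson_le N b : nsq N (poisson b) <= qf P b.
Proof.
elim: N b => [|N IH] b; first by rewrite /nsq big_nil.
rewrite /nsq sum_words_cons poisson_nil YE lerD2l; apply: ler_sum => j _.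
by under eq_bigr do rewrite poisson_cons; exact: IH.
Qed.

Let poisson_ge N b : (1 - rho ^+ N) * qf P b <= nsq N (poisson b).
Proof.
elim: N b => [|N IH] b; first by rewrite /nsq big_nil expr0 subrr mul0r.
rewrite /nsq sum_words_cons poisson_nil.
apply: le_trans (_ : rdot (Y *m b) (Y *m b) +
    (1 - rho ^+ N) * \sum_j qf P ((S j)^t* *m b) <= _); last first.
  rewrite lerD2l mulr_sumr; apply: ler_sum => j _.
  by under [leRHS]eq_bigr do rewrite poisson_cons; exact: IH.
rewrite mulrBl mul1r {1}YE mulrBl mul1r addrA lerD2l lerN2 exprSr -mulrA.
by rewrite ler_wpM2l // exprn_ge0 // ltW.
Qed.

(** The decisive gain: the whole kernel has mass [qf P b], but what lies off the root is already
    controlled by [Sq], hence by [r b]. *)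
Let poisson_tail N b :
  \sum_(j < n) \sum_(alpha <- words n N)
    rdot (poisson b (j :: alpha)) (poisson b (j :: alpha)) <= r b.
Proof.
apply: le_trans (SP_le_r b); apply: ler_sum => j _.
by under eq_bigr do rewrite poisson_cons; exact: poisson_le.
Qed.

Let rdot_lift N b phi : rdot b (lift N phi) =
  \sum_(alpha <- words n N) rdot (poisson b alpha) (phi alpha).
Proof.
rewrite rdot_sumr; apply: eq_bigr => a _.
by rewrite -[in LHS](adjK (word_mx S a)) -!rdot_adj !adjK.
Qed.

Let liftB N phi psi : lift N (fun a => phi a - psi a) = lift N phi - lift N psi.
Proof. by rewrite -sumrB; apply: eq_bigr => a _; rewrite !mulmxBr. Qed.

Let liftZ N (c : R[i]) phi : lift N (fun a => c *: phi a) = c *: lift N phi.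
Proof. by rewrite scaler_sumr; apply: eq_bigr => a _; rewrite -!scalemxAr. Qed.

Let lift_widen N L phi : (N <= L)%N -> supp N phi -> lift L phi = lift N phi.
Proof. by move=> NL h; apply: sum_words_widen => // a Na; rewrite h // !mulmx0. Qed.

(** Concatenation of words becomes the product of matrices, so [lift] intertwines multiplication by
    [p] with its value at [S]. *)
Let lift_vtensor p D N phi : supp D p -> supp N phi ->
  lift (N + D) (vtensor p phi) = poly_mx S p D *m lift N phi.
Proof.
move=> pD hN; rewrite mulmx_suml.
pose F (a b : word n) := p a *: (word_mx S (a ++ b) *m (Y^t* *m phi b)).
transitivity (\sum_(g <- words n (N + D)) \sum_(l < (size g).+1)
    F (take l g) (drop l g)).
  apply: eq_bigr => g _; rewrite /vtensor !mulmx_sumr.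
  by apply: eq_bigr => l _; rewrite /F cat_take_drop -!scalemxAr.
rewrite (@sum_words_sep _ _ D N) 1?addnC //; last first.
  move=> a b /orP[h|h]; first by rewrite /F (pD a) // scale0r.
  by rewrite /F (hN b) // !mulmx0 scaler0.
apply: eq_bigr => a _; rewrite mulmx_sumr; apply: eq_bigr => b _.
by rewrite /F word_mx_cat -scalemxAl mulmxA.
Qed.

(* Tested against its own Poisson transform, a functional that is bounded on
   lifts is bounded for the dual norm. *)
Let dual_le (t c : R) eta : 0 <= c ->
  (forall N phi, supp N phi -> 2 * rdot eta (lift N phi) <= c * t + nsq N phi) ->
  qf P eta <= c * t.
Proof.
move=> c0 H; apply/ler_addgt0Pr => d d0.
have PP : 0 < qf P eta + 1 by rewrite ltr_wpDl.
have [N rN] := exp_small (ltW rho0) rho1 (divr_gt0 d0 PP).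
pose phi (a : word n) := if (size a < N)%N then poisson eta a else 0.
have phiN : supp N phi by move=> a; rewrite /phi leqNgt => /negPf ->.
have E : nsq N phi = nsq N (poisson eta).
  rewrite /nsq !big_seq; apply: eq_bigr => a.
  by rewrite mem_words /phi => ->.
have := H N phi phiN; rewrite rdot_lift.
have -> : \sum_(a <- words n N) rdot (poisson eta a) (phi a) = nsq N phi.
  rewrite /nsq !big_seq; apply: eq_bigr => a.
  by rewrite mem_words /phi => ->.
rewrite E => h; have := poisson_ge N eta.
have : rho ^+ N * qf P eta <= d.
  apply: le_trans (_ : d / (qf P eta + 1) * qf P eta <= _).
    by rewrite ler_wpM2r.
  rewrite -mulrA ler_piMr ?(ltW d0) // mulrC ler_pdivrMr // mul1r lerDl //.
nra.
Qed.

Variables (p : word n -> R[i]) (D : nat).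
Hypotheses (pD : supp D p) (p_con : contractive p).
Let B := poly_mx S p D.
Let a := p [::].
Let A := complex.Re (a^* * a).
Hypothesis a1 : A < 1.
Let A0 : 0 <= A. Proof. exact: Re_mul_conj_ge0. Qed.

Lemma dual_poly_le b : qf P (B^t* *m b) <= qf P b.
Proof.
rewrite -[leRHS]mul1r; apply: dual_le => // N phi hN.
rewrite rdot_adj -lift_vtensor // rdot_lift mul1r.
have := sum_rdot_le (words n (N + D)) (poisson b) (vtensor p phi) ltr01.
rewrite invr1 !mul1r => h; apply: le_trans h _.
by apply: lerD; [exact: poisson_le | exact: p_con].
Qed.

Let C := a^* *: B.

Let dual_C_le M b : qf P (iter M (mulmx (C^t*)) b) <= A ^+ M * qf P b.
Proof.
elim: M => [|M IH] /=; first by rewrite expr0 mul1r.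
set u := iter _ _ _ in IH *.
have -> : qf P (C^t* *m u) = A * qf P (B^t* *m u).
  rewrite linearZ map_mxZ /= conjCK -scalemxAl /qf -scalemxAr rdotZZ scalerA.
  have -> : a^* * a = A%:C%C.
    by rewrite /A; case: (a) => c d /=; apply/eqP; rewrite eq_complex /= eqxx; apply/eqP; ring.
  by rewrite rdotZr.
by rewrite exprS -mulrA ler_wpM2l //; exact: le_trans (dual_poly_le u) IH.
Qed.

Let rdot_iter M u y : rdot (iter M (mulmx (C^t*)) u) y = rdot u (iter M (mulmx C) y).
Proof. by elim: M y => //= M IH y; rewrite rdot_adj IH -iterSr. Qed.

(** The sum is the adjoint of [(B - a) (1 - conj a B)^-1], with the Neumann series cut at [M],
    applied to [h]. On the Fock space the same truncation sends [phi] to [chi = (p - a) psi] with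
    [psi - conj a p psi = phi - f M]; by [nsq_moebius] its norm is at most that of [phi - f M], and
    [tau] bounds the remainder [f M]. *)
Let moebius_dual M (tau : R) h : 0 < tau -> A ^+ M <= tau ^+ 2 ->
  qf P (\sum_(m < M) iter m (mulmx (C^t*)) ((B - a%:M)^t* *m h)) <=
  (1 + tau) ^+ 2 * r h.
Proof.
move=> tau0 Atau; apply: dual_le => [|N phi hN]; first exact: sqr_ge0.
pose f m : word n -> 'cV[R[i]]_k :=
  iter m (fun g => (fun w => a^* *: vtensor p g w)) phi.
have fS m w : f m.+1 w = a^* *: vtensor p (f m) w by [].
have fsupp m : supp (N + m * D) (f m).
  elim: m => [|m IH]; first by rewrite mul0n addn0.
  move=> w hw; rewrite fS (vtensor_supp pD IH) ?scaler0 //.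
  by rewrite -addnA -mulSnr.
have flift m : lift (N + m * D) (f m) = iter m (mulmx C) (lift N phi).
  elim: m => [|m IH]; first by rewrite mul0n addn0.
  by rewrite mulSnr addnA liftZ lift_vtensor // IH /= /C -scalemxAl.
have fnsq m : nsq (N + m * D) (f m) <= A ^+ m * nsq N phi.
  elim: m => [|m IH]; first by rewrite mul0n addn0 expr0 mul1r.
  rewrite mulSnr addnA.
  have -> : nsq (N + m * D + D) (f m.+1) = A * nsq (N + m * D + D) (vtensor p (f m)).
    have -> : A = complex.Re (a^*^* * a^*) by rewrite conjCK mulrC.
    by rewrite -nsqZ.
  rewrite exprS -mulrA ler_wpM2l //; apply: le_trans IH; apply: p_con; exact: fsupp.
pose L := (N + M * D)%N.
have fsuppL m : (m <= M)%N -> supp L (f m).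
  move=> mM w hw; apply: fsupp; apply: leq_trans hw.
  by rewrite leq_add2l leq_mul2r mM orbT.
pose psi w := \sum_(m < M) f m w.
have psiL : supp L psi.
  by move=> w hw; rewrite /psi big1 // => m _; rewrite (fsuppL m) // ltnW.
have psi_lift : lift L psi = \sum_(m < M) iter m (mulmx C) (lift N phi).
  rewrite /lift /psi; under eq_bigr do rewrite !mulmx_sumr.
  rewrite exchange_big; apply: eq_bigr => m _.
  rewrite -flift -(@lift_widen _ L) //.
  by rewrite leq_add2l leq_mul2r ltnW ?orbT.
pose chi w := vtensor p psi w - a *: psi w.
have chiE : lift (L + D) chi = (B - a%:M) *m lift L psi.
  rewrite liftB lift_vtensor // liftZ (@lift_widen L) // ?leq_addr //.
  by rewrite mulmxBl mul_scalar_mx.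
have -> : rdot (\sum_(m < M) iter m (mulmx (C^t*)) ((B - a%:M)^t* *m h)) (lift N phi) =
    rdot h (lift (L + D) chi).
  rewrite chiE -rdot_adj psi_lift rdot_suml rdot_sumr.
  by apply: eq_bigr => m _; rewrite rdot_iter.
(* Because [a] is the constant term of [p], the root drops out of the pairing with the Poisson
   kernel and [poisson_tail] applies. *)
have chi0 : chi [::] = 0 by rewrite /chi vtensor_nil subrr.
have chi_le : nsq (L + D) chi <= (1 + tau) ^+ 2 * nsq N phi.
  apply: le_trans (nsq_moebius (ltW a1) _) _.
    by rewrite (nsq_widen (leq_addr _ _) psiL); exact: p_con.
  have -> : nsq (L + D) (fun w => psi w - a^* *: vtensor p psi w) =
            nsq (L + D) (fun w => phi w - f M w).
    apply: eq_bigr => w _.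
    suff -> : psi w - a^* *: vtensor p psi w = phi w - f M w by [].
    rewrite vtensor_sum scaler_sumr /psi.
    under [X in _ - X]eq_bigr do rewrite -fS.
    by rewrite -sumrB (telescope_ord (fun m => f m w)).
  apply: le_trans (nsq_sub_le _ _ _ tau0) _.
  rewrite (@nsq_widen _ _ _ N) //; last by rewrite /L -addnA leq_addr.
  rewrite (@nsq_widen _ _ _ L _ (f M)) ?leq_addr //; last exact: fsuppL (leqnn M).
  have := fnsq M; rewrite -/L => fM.
  have n0 := nsq_ge0 N phi.
  have fM2 : nsq L (f M) <= tau ^+ 2 * nsq N phi.
    by apply: le_trans fM _; rewrite ler_wpM2r.
  have ti : 0 <= 1 + tau^-1 by rewrite addr_ge0 // invr_ge0 ltW.
  have := ler_wpM2l ti fM2.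
  have -> : (1 + tau^-1) * (tau ^+ 2 * nsq N phi) = (tau ^+ 2 + tau) * nsq N phi.
    by field; rewrite gt_eqF.
  nra.
rewrite rdot_lift.
case: (L + D)%N chi_le => [|L'] chi_le.
  by rewrite big_nil mulr0 addr_ge0 ?nsq_ge0 // mulr_ge0 ?sqr_ge0.
rewrite sum_words_cons chi0 rdot0r add0r.
have t0 : 0 < (1 + tau) ^+ 2 by rewrite exprn_gt0 // addr_gt0.
have step : 2 * \sum_(j < n) \sum_(w <- words n L')
      rdot (poisson h (j :: w)) (chi (j :: w)) <=
    (1 + tau) ^+ 2 * \sum_(j < n) \sum_(w <- words n L')
      rdot (poisson h (j :: w)) (poisson h (j :: w)) +
    ((1 + tau) ^+ 2)^-1 * \sum_(j < n) \sum_(w <- words n L')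
      rdot (chi (j :: w)) (chi (j :: w)).
  rewrite !mulr_sumr -big_split /=; apply: ler_sum => j _.
  exact: (sum_rdot_le _ (fun w => poisson h (j :: w)) (fun w => chi (j :: w))).
apply: le_trans step _; apply: lerD.
  by rewrite ler_pM2l // poisson_tail.
rewrite mulrC ler_pdivrMr // mulrC; apply: le_trans chi_le.
by rewrite /nsq sum_words_cons chi0 rdot0r add0r.
Qed.

(* With [A = (B - a) (1 - conj a B)^-1], which satisfies [r >= A P A^*], this
   is [2 Re <h, A y> <= r h + q y]; the inverse is approximated by partial
   sums of the Neumann series. *)
Lemma moebius_form_le h x :
  2 * rdot h (B *m x - a *: x) <=
  2 * rdot h h - qf q h + qf q (x - a^* *: (B *m x)).
Proof.
rewrite -/(r h); set y := x - _.
pose l := (B - a%:M)^t* *m h.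
have Pl := P_ge0 l; have qx := posdef_ge0 e0 qe x; have rh := r_ge0 h.
(* [K] collects the errors of order [tau]: [3 * r h] from [(1 + tau) ^+ 2] and [qf P l + qf q x]
   from the Neumann remainder. *)
set K := r h + (qf P l + qf q x) + 2 * r h.
have K0 : 0 <= K.
  by rewrite /K; lra.
apply/ler_addgt0Pr => d d0.
pose tau := Num.min 1 (d / (K + 1)).
have K1 : 0 < K + 1 by rewrite ltr_wpDl.
have tau0 : 0 < tau by rewrite lt_min ltr01 divr_gt0.
have tau1 : tau <= 1 by rewrite ge_min lexx.
have tauK : tau * K <= d.
  apply: le_trans (_ : d / (K + 1) * K <= _).
    by rewrite ler_wpM2r // ge_min lexx orbT.
  by rewrite -mulrA ler_piMr ?(ltW d0) // mulrC ler_pdivrMr // mul1r lerDl.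
have [M AM] := exp_small A0 a1 (exprn_gt0 2 tau0).
have H1 := moebius_dual h tau0 AM.
set eta := \sum_(m < M) _ in H1.
have H2 := Pyoung eta y.
have etaE : rdot eta y = rdot h (B *m x - a *: x) - rdot l (iter M (mulmx C) x).
  rewrite rdot_suml; under eq_bigr do rewrite rdot_iter.
  rewrite -rdot_sumr -mul_scalar_mx -mulmxBl -rdot_adj -/l -rdotBr; congr rdot.
  rewrite -(telescope_ord (fun m => iter m (mulmx C) x)).
  apply: eq_bigr => m _ /=.
  have -> : y = x - C *m x by rewrite /y /C scalemxAl.
  by elim: (nat_of_ord m) => //= j ->; rewrite mulmxBr.
have H3 := dual_C_le M l.
(* With [x] scaled by [tau] both terms on the right are of order [tau ^+ 2], so one factor [tau] is
   left after division. *)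
have H4 := Pyoung (iter M (mulmx (C^t*)) l) (tau%:C%C *: x).
rewrite rdotZr rdot_iter qf_scale in H4.
have H5 : 2 * rdot l (iter M (mulmx C) x) <= tau * (qf P l + qf q x).
  rewrite -(ler_pM2l tau0).
  have : qf P (iter M (mulmx (C^t*)) l) <= tau ^+ 2 * qf P l.
    by apply: le_trans H3 _; rewrite ler_wpM2r.
  nra.
have : (1 + tau) ^+ 2 * r h <= r h + tau * (3 * r h).
  have -> : r h + tau * (3 * r h) = (1 + 3 * tau) * r h by ring.
  by rewrite ler_wpM2r //; nra.
rewrite /K in tauK; nra.
Qed.

End Poisson.

(** * Polynomials in matrices *)

(** For [r > 0] the multiplier [s / r] is optimal. For [r = 0] large multiples of [s] force
    [s = 0]. *)
Lemma discr_le (R : realFieldType) (s1 s2 r kappa : R) : 0 <= r -> 0 <= kappa ->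
  (forall l1 l2, 2 * (l1 * s1 + l2 * s2) <= (l1 ^+ 2 + l2 ^+ 2) * r + kappa) ->
  s1 ^+ 2 + s2 ^+ 2 <= kappa * r.
Proof.
move=> r0 k0 H; set S := s1 ^+ 2 + s2 ^+ 2.
have HS t : 2 * t * S <= t ^+ 2 * S * r + kappa.
  by have := H (t * s1) (t * s2); rewrite /S; nra.
have S0 : 0 <= S by rewrite addr_ge0 // sqr_ge0.
have [r1|rn] := eqVneq r 0.
  have [->|Sn] := eqVneq S 0; first by rewrite mulr_ge0.
  have := HS ((kappa + 1) / S).
  have -> : 2 * ((kappa + 1) / S) * S = 2 * (kappa + 1) by field.
  by rewrite r1 mulr0 add0r => h; lra.
have rp : 0 < r by rewrite lt_def rn.
have := HS r^-1.
have -> : r^-1 ^+ 2 * S * r = r^-1 * S by field.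
move=> h; rewrite -ler_pdivrMr // mulrC; lra.
Qed.

Section MatrixBound.
Variables (R : realType) (n k : nat).
Implicit Types (x y h v : 'cV[R[i]]_k).

Lemma rdotZlE (u : R[i]) x y :
  rdot (u *: x) y = complex.Re u * rdot x y + complex.Im u * rdot ('i%C *: x) y.
Proof.
have -> : u *: x = (complex.Re u)%:C%C *: x + (complex.Im u)%:C%C *: ('i%C *: x).
  rewrite scalerA -scalerDl; congr (_ *: _).
  by case: u => a b; apply/eqP; rewrite eq_complex /=; apply/andP; split; apply/eqP; ring.
by rewrite rdotDl !rdotZl.
Qed.

Lemma rdotiC x y : rdot ('i%C *: x) y = - rdot ('i%C *: y) x.
Proof.
rewrite rdotZZ rdotC.
have -> : ('i%C : R[i])^* = - 'i%C.
  by apply/eqP; rewrite eq_complex /= oppr0 !eqxx.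
by rewrite scaleNr rdotNl.
Qed.

Lemma rdotixx x : rdot ('i%C *: x) x = 0.
Proof. by have := rdotiC x x => ?; lra. Qed.

Lemma qfZc (q : 'M[R[i]]_k) (u : R[i]) x :
  qf q (u *: x) = complex.Re (u^* * u) * qf q x.
Proof.
rewrite /qf -scalemxAr rdotZZ scalerA.
have -> : u^* * u = (complex.Re (u^* * u))%:C%C.
  by case: u => c d /=; apply/eqP; rewrite eq_complex /= eqxx; apply/eqP; ring.
by rewrite rdotZr.
Qed.

Lemma moebius_bounds (a : R[i]) (kappa : R) x z :
  let y := x - a^* *: z in let v := z - a *: x in
  let A := complex.Re (a^* * a) in
  A < 1 -> 0 <= kappa -> kappa <= 2 * rdot y y -> rdot v v <= 2 * kappa ->
  (rdot y v) ^+ 2 + (rdot ('i%C *: y) v) ^+ 2 <= kappa * (2 * rdot y y - kappa) ->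
  rdot z z <= 4 * rdot x x /\
  forall zeta : R[i], complex.Re (zeta^* * zeta) = 1 ->
    rdot (zeta *: x) z <= 5 / 4 * rdot x x.
Proof.
move=> y v A A1 k0 kY mk Sk.
have AE : A = complex.Re a ^+ 2 + complex.Im a ^+ 2.
  by rewrite /A; case: (a) => a1 a2 /=; ring.
have aaC : a^* * a = A%:C%C.
  by rewrite /A; case: (a) => c d /=; apply/eqP; rewrite eq_complex /= eqxx; apply/eqP; ring.
have xE : y + a^* *: v = (1 - A)%:C%C *: x.
  rewrite /y /v scalerBr scalerA aaC addrA subrK rmorphB scalerBl /=.
  by rewrite scale1r.
have zE : v + a *: y = (1 - A)%:C%C *: z.
  rewrite /y /v scalerBr scalerA (mulrC a) aaC addrA subrK rmorphB scalerBl /=.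
  by rewrite scale1r.
clearbody y v.
set Y := rdot y y in kY Sk; set m := rdot v v in mk.
set s1 := rdot y v in Sk; set s2 := rdot _ v in Sk.
have SmY : s1 ^+ 2 + s2 ^+ 2 <= m * Y.
  apply: discr_le; [exact: rdot_ge0|exact: rdot_ge0|move=> l1 l2].
  have := rdot_ge0 (Complex l1 l2 *: y - v).
  rewrite !rdotBl !rdotBr rdotZ_norm (rdotC v) rdotZlE /= -/s1 -/s2 -/Y -/m.
  by rewrite mulNr opprK -!expr2; nra.
have A1' : 0 < (1 - A) ^+ 2 by rewrite exprn_gt0 // subr_gt0.
have Y0 : 0 <= Y by exact: rdot_ge0.
have m0 : 0 <= m by exact: rdot_ge0.
pose w := complex.Re a * s1 + complex.Im a * s2.
have ayv : rdot (a *: y) v = w by rewrite rdotZlE.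
have X2 : (1 - A) ^+ 2 * rdot x x = Y + 2 * w + A * m.
  rewrite expr2 -mulrA -rdotZr -rdotZl -xE rdotDl !rdotDr rdotZ_norm conjCK (mulrC a).
  by rewrite (rdotC _ y) -(rdotZZ a) ayv -/Y -/m -/A; ring.
have Z2 : (1 - A) ^+ 2 * rdot z z = m + 2 * w + A * Y.
  rewrite expr2 -mulrA -rdotZr -rdotZl -zE rdotDl !rdotDr rdotZ_norm.
  by rewrite (rdotC v) ayv -/Y -/m -/A; ring.
split.
  rewrite -(ler_pM2l A1') Z2 mulrCA X2 AE; rewrite AE in A1.
  by apply: moebius_norm_le Sk SmY mk (ltW A1).
move=> zeta z1.
rewrite -(ler_pM2l A1') mulrCA X2 AE.
have {}z1 : complex.Re zeta ^+ 2 + (- complex.Im zeta) ^+ 2 = 1.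
  by rewrite -z1; case: (zeta) => c d /=; ring.
rewrite AE in A1.
have := moebius_numrange_le Y0 m0 k0 kY Sk SmY mk (ltW A1) z1.
rewrite -/w; apply: le_trans.
have -> : (1 - (complex.Re a ^+ 2 + complex.Im a ^+ 2)) ^+ 2 * rdot (zeta *: x) z =
   rdot (zeta *: (y + a^* *: v)) (v + a *: y).
  by rewrite xE zE scalerA [zeta * _]mulrC -scalerA rdotZl rdotZr -AE; ring.
rewrite scalerDr rdotDl !rdotDr scalerA.
have rZr u x1 y1 : rdot (u *: x1) (a *: y1) = rdot ((a^* * u) *: x1) y1.
  by rewrite -scalerA [RHS]rdotZZ conjCK.
rewrite !rZr (rdotZlE zeta) (rdotZlE (_ * zeta)) (rdotZlE (zeta * _) v v) (rdotZlE _ v y).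
rewrite (rdotC v y) (rdotiC v y) -/s1 -/s2 -/Y -/m !rdotixx.
case: (a) => a1 a2; case: (zeta) => c d /=.
by rewrite le_eqVlt; apply/orP; left; apply/eqP; ring.
Qed.
End MatrixBound.

Section PolyBound.
Variables (R : realType) (n k : nat).

Lemma word_mxZ (c : R[i]) (T : 'I_n -> 'M[R[i]]_k) (alpha : word n) :
  word_mx (fun j => c *: T j) alpha = c ^+ size alpha *: word_mx T alpha.
Proof.
elim: alpha => [|j a IH] /=; first by rewrite expr0 scale1r.
by rewrite IH -scalemxAl -scalemxAr scalerA exprS.
Qed.

(** Why [c ^+ 2]: [ando_form] makes [c T] a row contraction for [P] dominated by [2 - q], and the
    second factor [c] supplies the strict constant [rho = c ^+ 2] that the Poisson kernel needs. *)
Lemma poly_mx_bounds (T : 'I_n -> 'M[R[i]]_k) (p : word n -> R[i]) D (c : R) x :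
  numrange_le T 1 -> supp D p -> contractive k p ->
  complex.Re ((p [::])^* * p [::]) < 1 -> 0 < c -> c < 1 ->
  let z := poly_mx (fun j => (c ^+ 2)%:C%C *: T j) p D *m x in
  rdot z z <= 4 * rdot x x /\
  forall zeta : R[i], complex.Re (zeta^* * zeta) = 1 ->
    rdot (zeta *: x) z <= 5 / 4 * rdot x x.
Proof.
move=> T1 pD p_con a1 c0 c1 z.
have [q [e [qH e0 qe Hq]]] := ando_form (ltW c0) c1 T1.
set P := invmx q.
have P_sum b : c ^+ 2 * \sum_j qf P ((T j)^t* *m b) <= 2 * rdot b b - qf q b.
  (* These vectors maximize [2 * c * rdot b (T j *m z) - qf q z], which recovers the inverse of [q]
     from the affine inequality. *)
  have := Hq b (fun j => c%:C%C *: (P *m ((T j)^t* *m b))).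
  under eq_bigr do rewrite -rdot_adj rdotZr.
  under [X in _ + X]eq_bigr do rewrite qf_scale -(qf_inv qH e0 qe).
  rewrite -!mulr_sumr; rewrite -[\sum_j rdot _ _]/(\sum_j qf P ((T j)^t* *m b)).
  by rewrite expr2; nra.
have S_sum b : \sum_j qf P (((c ^+ 2)%:C%C *: T j)^t* *m b) <=
    c ^+ 2 * (2 * rdot b b - qf q b).
  apply: le_trans (ler_wpM2l (sqr_ge0 c) (P_sum b)).
  rewrite !mulr_sumr; apply: ler_sum => j _.
  rewrite linearZ map_mxZ /= conj_real -scalemxAl qf_scale.
  by rewrite le_eqVlt; apply/orP; left; apply/eqP; ring.
have c20 : 0 < c ^+ 2 by rewrite exprn_gt0.
have c21 : c ^+ 2 < 1 by rewrite expr2; nra.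
have main h := moebius_form_le qH e0 qe c20 c21 S_sum pD p_con a1 h x.
rewrite -/z in main; set a := p [::] in main a1.
set y := x - _ in main; set v := z - _ in main.
have q0 w : 0 <= qf q w := posdef_ge0 e0 qe w.
have qle w : qf q w <= 2 * rdot w w.
  have := Hq w (fun=> 0); rewrite big1 => [|j _]; last by rewrite mulmx0 rdot0r.
  rewrite big1 => [|j _]; last by rewrite /qf mulmx0 rdot0r.
  by rewrite mulr0 addr0 subr_ge0.
apply: (@moebius_bounds _ _ a (qf q y)) => //.
  (* [1/2] is the best multiple of [v]; it gives [|v|^2 <= |v|^2 / 2 + kappa]. *)
  have := main ((2^-1)%:C%C *: v); rewrite !rdotZl rdotZr qf_scale -/v.
  by have := q0 v; have := rdot_ge0 v; lra.
rewrite -/y -/v; apply: discr_le => // [|l1 l2]; first by rewrite subr_ge0.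
have := main (Complex l1 l2 *: y); rewrite rdotZ_norm qfZc (rdotZlE (Complex l1 l2)) /=.
by rewrite mulNr opprK -!expr2; lra.
Qed.

End PolyBound.

(** * Fock space norms as bounds on finite sums *)

Section Norms.
Variable R : realType.

Lemma rnorm_sqr (z : R[i]) : rnorm z ^+ 2 = complex.Re (z^* * z).
Proof.
rewrite /rnorm; case: z => a b /=.
by rewrite sqr_sqrtr ?addr_ge0 ?sqr_ge0 // mulNr opprK -!expr2.
Qed.

Lemma rnorm_ge0 (V : normedModType R[i]) (x : V) : 0 <= rnorm x.
Proof. by have := normr_ge0 x; rewrite /rnorm; case: `|x| => a b /andP[]. Qed.

Lemma rnormE (V : normedModType R[i]) (x : V) : `|x| = (rnorm x)%:C%C.
Proof.
have := normr_ge0 x; rewrite /rnorm; case: `|x| => a b /andP[/eqP /= -> _].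
by [].
Qed.

Lemma Re_le_rnorm (z : R[i]) : complex.Re z <= rnorm z.
Proof.
apply: ler_sqr_lin; first exact: (@rnorm_ge0 R[i]^o z).
by rewrite rnorm_sqr; case: z => a b /=; rewrite mulNr opprK -!expr2 lerDl sqr_ge0.
Qed.

Lemma rdot_rnorm (x : 'cV[R[i]]_1) : rdot x x = rnorm (x 0 0) ^+ 2.
Proof. by rewrite /rdot big_ord1 rnorm_sqr. Qed.

Variable n : nat.
Implicit Types (f p : word n -> R[i]).

Lemma esum_words_leP (f : word n -> R) (C : R) : (forall a, 0 <= f a) ->
  ((\esum_(alpha in [set: word n]) (f alpha)%:E)%E <= C%:E)%E <->
  forall N, \sum_(alpha <- words n N) f alpha <= C.
Proof.
move=> f0; split=> [H N|H].
  rewrite -lee_fin; apply: le_trans H; apply: esum_ge.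
  exists [set` words n N]%classic; first by split => //; exact: finite_seq.
  by rewrite -fsbig_seq ?uniq_words // sumEFin.
apply: ge_ereal_sup => _ [F [finF _] <-].
have [N FN] : exists N, (F `<=` [set` words n N])%classic.
  pose s := fset_set F.
  exists (\max_(a <- s) size a).+1 => a Fa /=; rewrite mem_words ltnS.
  rewrite (big_rem a) ?leq_maxl //=.
  by rewrite /s in_fset_set // inE.
apply: le_trans (_ : (\sum_(a \in [set` words n N]) (f a)%:E <= _)%E).
  apply: lee_fsum_nneg_subset => //; [exact: finite_seq|exact/subsetP|].
  by move=> t _; rewrite lee_fin.
by rewrite -fsbig_seq ?uniq_words // sumEFin lee_fin.
Qed.

Lemma esum_words_supp (f : word n -> R) N : (forall a, 0 <= f a) ->
  (forall a, (N <= size a)%N -> f a = 0) ->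
  (\esum_(alpha in [set: word n]) (f alpha)%:E =
   (\sum_(alpha <- words n N) f alpha)%:E)%E.
Proof.
move=> f0 fN; apply/eqP; rewrite eq_le; apply/andP; split.
  apply/esum_words_leP => // M; have [MN|/ltnW NM] := leqP M N.
    pose g a := if (size a < M)%N then f a else 0.
    have -> : \sum_(a <- words n M) f a = \sum_(a <- words n M) g a.
      by rewrite !big_seq; apply: eq_bigr => a; rewrite mem_words /g => ->.
    rewrite -(sum_words_widen MN) => [|a]; last by rewrite /g leqNgt => /negPf ->.
    by apply: ler_sum => a _; rewrite /g; case: ifP.
  by rewrite (sum_words_widen NM).
apply: esum_ge; exists [set` words n N]%classic; first by split => //; exact: finite_seq.
by rewrite -fsbig_seq ?uniq_words // sumEFin.
Qed.

Lemma norm2_leP f (C : R) : 0 <= C ->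
  (norm2 f <= C%:E)%E <->
  forall N, \sum_(alpha <- words n N) rnorm (f alpha) ^+ 2 <= C ^+ 2.
Proof.
move=> C0; rewrite -esum_words_leP => [|a]; last exact: sqr_ge0.
rewrite /norm2; set E := esum _ _.
have E0 : (0 <= E)%E by apply: esum_ge0 => a _; rewrite lee_fin sqr_ge0.
rewrite poweR12_sqrt //.
have -> : C%:E = sqrte ((C ^+ 2)%:E) by rewrite /= sqrtr_sqr ger0_norm.
by rewrite lee_sqrt // lee_fin sqr_ge0.
Qed.

Definition tens_bound p (C : R) := forall N phi,
  supp N phi -> forall L,
  \sum_(a <- words n L) rnorm (tensor p phi a) ^+ 2 <=
  C ^+ 2 * \sum_(a <- words n N) rnorm (phi a) ^+ 2.

Lemma ncpolyP f : ncpoly f <-> exists N, supp N f.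
Proof. by split => -[N fN]; [exists N.+1|exists N => a Na; apply: fN; exact: ltnW]. Qed.

Lemma tensorZr p (c : R[i]) f a : tensor p (fun b => c * f b) a = c * tensor p f a.
Proof. by rewrite mulr_sumr; apply: eq_bigr => l _; rewrite mulrCA. Qed.

Lemma norm_infty_leP p (C : R) : 0 <= C ->
  (norm_infty p <= C%:E)%E <-> tens_bound p C.
Proof.
move=> C0; split=> [H N phi phiN L|H].
  set X := \sum_(a <- words n N) _.
  have X0 : 0 <= X by apply: sumr_ge0 => a _; exact: sqr_ge0.
  have [XE|Xn] := eqVneq X 0.
    have phi0 a : phi a = 0.
      have [|aN] := leqP N (size a); first exact: phiN.
      move: XE => /eqP; rewrite psumr_eq0; last by move=> *; exact: sqr_ge0.
      move=> /allP /(_ a); rewrite mem_words => /(_ aN) /=; rewrite sqrf_eq0 => /eqP h.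
      by apply/eqP; rewrite -normr_eq0 (@rnormE R[i]^o) h.
    rewrite XE mulr0 big1 // => a _.
    rewrite /tensor big1 ?[rnorm _]normr0 => [|l _]; last by rewrite phi0 mulr0.
    by rewrite /rnorm normr0 expr0n.
  have Xp : 0 < X by rewrite lt_def Xn.
  pose c := (Num.sqrt X)^-1; pose psi a := c%:C%C * phi a.
  have c2 : c ^+ 2 = X^-1 by rewrite /c exprVn sqr_sqrtr.
  have rc z : rnorm (c%:C%C * z) ^+ 2 = X^-1 * rnorm z ^+ 2.
    rewrite -c2 !rnorm_sqr rmorphM /= conj_real; case: z => u v /=; ring.
  have psi1 : (norm2 psi <= 1%:E)%E.
    apply/norm2_leP => // M; rewrite expr1n.
    have -> : 1 = X^-1 * X by rewrite mulVf.
    under eq_bigr do rewrite rc.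
    rewrite -mulr_sumr ler_pM2l ?invr_gt0 //.
    have h : (\esum_(alpha in [set: word n]) (rnorm (phi alpha) ^+ 2)%:E <= X%:E)%E.
      rewrite (@esum_words_supp _ N) // => [a|a Na]; first exact: sqr_ge0.
      by rewrite phiN // /rnorm normr0 expr0n.
    by move/esum_words_leP : h; apply => a; exact: sqr_ge0.
  have : (norm2 (tensor p psi) <= C%:E)%E.
    apply: le_trans H; apply: ereal_sup_ubound; exists psi => //; split=> //.
    by apply/ncpolyP; exists N => a Na; rewrite /psi phiN // mulr0.
  move/norm2_leP => /(_ C0 L).
  under eq_bigr do rewrite /psi tensorZr rc.
  by rewrite -mulr_sumr mulrC ler_pdivrMr.
apply: ge_ereal_sup => _ [phi [/ncpolyP[N phiN] phi1] <-].
apply/norm2_leP => // L; apply: le_trans (H N phi phiN L) _.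
rewrite ler_piMr ?sqr_ge0 //.
by move/norm2_leP : phi1 => /(_ ler01 N); rewrite expr1n.
Qed.

Lemma tens_boundB p r (C1 C2 : R) : 0 < C1 -> 0 < C2 ->
  tens_bound p C1 -> tens_bound r C2 -> tens_bound (fun a => p a - r a) (C1 + C2).
Proof.
move=> C10 C20 H1 H2 N phi phiN L.
have {}H1 := H1 N phi phiN L; have {}H2 := H2 N phi phiN L.
pose emb f : word n -> 'cV[R[i]]_1 := fun a => (f a)%:M.
have embE f : \sum_(a <- words n L) rnorm (f a) ^+ 2 = nsq L (emb f).
  by apply: eq_bigr => a _; rewrite rdot_rnorm mxE eqxx mulr1n.
(* With this ratio the parametrized inequality adds up to exactly [(C1 + C2) ^+ 2]. *)
have t0 : 0 < C2 / C1 by rewrite divr_gt0.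
have := nsq_sub_le L (emb (tensor p phi)) (emb (tensor r phi)) t0.
rewrite -!embE => h.
have E : \sum_(a <- words n L) rnorm (tensor (fun a0 => p a0 - r a0) phi a) ^+ 2 =
   nsq L (fun a => emb (tensor p phi) a - emb (tensor r phi) a).
  apply: eq_bigr => a _; rewrite rdot_rnorm !mxE eqxx !mulr1n -sumrB.
  congr (rnorm _ ^+ 2); apply: eq_bigr => l _; by rewrite mulrBl.
rewrite E; apply: le_trans h _.
set X := \sum_(a <- words n N) _ in H1 H2 *.
have -> : (C1 + C2) ^+ 2 * X = (1 + C2 / C1) * (C1 ^+ 2 * X) + (1 + (C2 / C1)^-1) * (C2 ^+ 2 * X).
  by field; rewrite !gt_eqF.
by apply: lerD; rewrite ler_wpM2l // addr_ge0 // ?invr_ge0 ltW.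
Qed.

(** Multiplication by [p] acts on each coordinate separately, so the scalar bound passes to vectors
    with the same constant. *)
Lemma tens_bound_contractive k p : tens_bound p 1 -> contractive k p.
Proof.
move=> H N phi phiN L.
have E M (psi : word n -> 'cV[R[i]]_k) :
    nsq M psi = \sum_(i < k) \sum_(a <- words n M) rnorm (psi a i 0) ^+ 2.
  rewrite exchange_big; apply: eq_bigr => a _.
  rewrite /rdot complexRe_sum; by apply: eq_bigr => i _; rewrite rnorm_sqr.
rewrite !E; apply: ler_sum => i _.
have := H N (fun a => phi a i 0); rewrite expr1n mul1r => h.
have sN : supp N (fun a => phi a i 0) by move=> a Na; rewrite phiN // mxE.
apply: le_trans (h sN L).
rewrite le_eqVlt; apply/orP; left; apply/eqP; apply: eq_bigr => a _.
congr (rnorm _ ^+ 2); rewrite summxE; apply: eq_bigr => l _.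
by rewrite mxE.
Qed.

Lemma tens_bound_coef0 p : tens_bound p 1 -> complex.Re ((p [::])^* * p [::]) <= 1.
Proof.
move=> H; pose one (a : word n) : R[i] := if a is [::] then 1 else 0.
have one1 : supp 1 one by case.
have := H 1 one one1 1; rewrite !sum_words_cons !big1 //; try by move=> j _; rewrite big_nil.
rewrite expr1n mul1r !addr0 /tensor big_ord1 /= mulr1 !rnorm_sqr => /le_trans; apply.
by rewrite rmorph1 mul1r.
Qed.

End Norms.

(** * Compression to a finite dimensional space *)

Section HilbertSpace.
Variables (R : realType) (H : normedModType R[i]) (dot : {dot H for Num.conj}).
Hypothesis dot_norm : forall x : H, `|x| ^+ 2 = dot x x.
Implicit Types (x y u v : H).

Lemma dotC x y : dot y x = (dot x y)^*.
Proof. by rewrite (hermitian_subproof y x) expr0 mul1r. Qed.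

Lemma dotZl (c : R[i]) x y : dot (c *: x) y = c * dot x y.
Proof. exact: linearZl_LR. Qed.

Lemma dotZr (c : R[i]) x y : dot x (c *: y) = c^* * dot x y.
Proof. exact: linearZr_LR. Qed.

Lemma dotDl x y z : dot (x + y) z = dot x z + dot y z.
Proof. exact: linearDl. Qed.

Lemma dotBl x y z : dot (x - y) z = dot x z - dot y z.
Proof. exact: linearBl. Qed.

Lemma dot0l z : dot 0 z = 0.
Proof. exact: linear0l. Qed.

Lemma dot_suml (I : Type) (r : seq I) (F : I -> H) z :
  dot (\sum_(i <- r) F i) z = \sum_(i <- r) dot (F i) z.
Proof. exact: linear_sumlz. Qed.

Lemma dot_sumr (I : Type) (r : seq I) (F : I -> H) z :
  dot z (\sum_(i <- r) F i) = \sum_(i <- r) dot z (F i).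
Proof. exact: linear_sumr. Qed.

Lemma dot_real x : dot x x = (rnorm x ^+ 2)%:C%C.
Proof. by rewrite -dot_norm rnormE -rmorphXn. Qed.

Lemma rnorm_dot x : rnorm x ^+ 2 = complex.Re (dot x x).
Proof. by rewrite dot_real. Qed.

Lemma rnormZ (c : R[i]) x : rnorm (c *: x) = rnorm c * rnorm x.
Proof.
rewrite {1}/rnorm normrZ rnormE (@rnormE R R[i]^o c) -rmorphM /=.
by [].
Qed.

Lemma rnorm_eq0 x : rnorm x = 0 -> x = 0.
Proof. by move=> h; apply/eqP; rewrite -normr_eq0 rnormE h. Qed.

Section Frame.
Variables (k : nat) (e : 'I_k -> H).

Definition frame (c : 'cV[R[i]]_k) : H := \sum_(i < k) c i 0 *: e i.
Definition coordinates (u : H) : 'cV[R[i]]_k := \col_i dot u (e i).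

Lemma frameD c d : frame (c + d) = frame c + frame d.
Proof. by rewrite -big_split; apply: eq_bigr => i _; rewrite mxE scalerDl. Qed.

Lemma frameZ (a : R[i]) c : frame (a *: c) = a *: frame c.
Proof. by rewrite scaler_sumr; apply: eq_bigr => i _; rewrite mxE scalerA. Qed.

Lemma frame0 : frame 0 = 0.
Proof. by rewrite /frame big1 // => i _; rewrite mxE scale0r. Qed.

Lemma coordinatesD u v : coordinates (u + v) = coordinates u + coordinates v.
Proof. by apply/colP => i; rewrite !mxE dotDl. Qed.

Lemma coordinatesZ (a : R[i]) u : coordinates (a *: u) = a *: coordinates u.
Proof. by apply/colP => i; rewrite !mxE dotZl. Qed.

Lemma coordinates0 : coordinates 0 = 0.
Proof. by apply/colP => i; rewrite !mxE dot0l. Qed.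

Lemma dot_frame u c : dot u (frame c) = \sum_i (c i 0)^* * dot u (e i).
Proof. by rewrite dot_sumr; apply: eq_bigr => i _; rewrite dotZr. Qed.

Lemma rdot_coord c u : rdot c (coordinates u) = complex.Re (dot u (frame c)).
Proof.
by rewrite dot_frame /rdot; congr complex.Re; apply: eq_bigr => i _; rewrite mxE.
Qed.

Definition orthonormal_family := forall i j, dot (e i) (e j) = (i == j)%:R.

Lemma coord_frame : orthonormal_family -> forall c, coordinates (frame c) = c.
Proof.
move=> eON c; apply/colP => i; rewrite mxE dot_suml (bigD1 i) //= dotZl eON eqxx.
by rewrite mulr1 big1 ?addr0 // => j ji; rewrite dotZl eON (negPf ji) mulr0.
Qed.

Definition compression (T : H -> H) : 'M[R[i]]_k := \matrix_(i, j) dot (T (e j)) (e i).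

Lemma compressionE (T : {linear H -> H}) c : compression T *m c = coordinates (T (frame c)).
Proof.
apply/colP => i; rewrite !mxE linear_sum dot_suml; apply: eq_bigr => j _.
by rewrite mxE linearZ dotZl mulrC.
Qed.

End Frame.

Lemma exists_frame (s : seq H) : exists (k : nat) (e : 'I_k -> H),
  orthonormal_family e /\ forall u, u \in s -> frame e (coordinates e u) = u.
Proof.
elim: s => [|u s [k [e [eON es]]]].
  by exists 0%N, (fun _ => 0); split=> // -[].
have [w0|wn] := eqVneq (u - frame e (coordinates e u)) 0.
  exists k, e; split=> // v; rewrite inE => /predU1P[->|/es //].
  by move/eqP: w0; rewrite subr_eq0 => /eqP <-.
set w := u - _ in wn.
have we i : dot w (e i) = 0.
  rewrite /w dotBl.
  have := coord_frame eON (coordinates e u) => /colP/(_ i); rewrite !mxE => ->.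
  by rewrite subrr.
have rw : rnorm w != 0 by apply: contra wn => /eqP/rnorm_eq0 ->.
pose g := ((rnorm w)^-1)%:C%C *: w.
have gg : dot g g = 1.
  rewrite dotZl dotZr conj_real dot_real -!rmorphM /=.
  by rewrite [X in X%:C%C](_ : _ = 1) //; field.
have ge i : dot g (e i) = 0 by rewrite dotZl we mulr0.
have eg i : dot (e i) g = 0 by rewrite dotC ge rmorph0.
pose e' (i : 'I_k.+1) := if unlift ord0 i is Some j then e j else g.
have e'0 : e' ord0 = g by rewrite /e' unlift_none.
have e'S j : e' (lift ord0 j) = e j by rewrite /e' liftK.
have frame' c : frame e' c = c ord0 0 *: g + frame e (\col_j c (lift ord0 j) 0).
  rewrite /frame big_ord_recl e'0; congr (_ + _).
  by apply: eq_bigr => j _; rewrite e'S mxE.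
have framecoord v : frame e' (coordinates e' v) = dot v g *: g + frame e (coordinates e v).
  rewrite frame' mxE e'0; congr (_ + frame e _).
  by apply/colP => j; rewrite !mxE e'S.
exists k.+1, e'; split=> [i j|v].
  case: (unliftP ord0 i) => [i' ->|->]; case: (unliftP ord0 j) => [j' ->|->].
  - by rewrite !e'S eON (inj_eq lift_inj).
  - by rewrite e'0 e'S eg eq_sym (negPf (neq_lift _ _)).
  - by rewrite e'0 e'S ge (negPf (neq_lift _ _)).
  - by rewrite e'0 gg eqxx.
have wg : dot w g *: g = w.
  rewrite dotZr conj_real scalerA dot_real -!rmorphM /= expr2.
  by rewrite mulrCA mulrA divfK // divff // scale1r.
have fg c : dot (frame e c) g = 0.
  by rewrite dot_suml big1 // => i _; rewrite dotZl eg mulr0.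
rewrite inE framecoord => /predU1P[->|vs].
  have -> : dot u g = dot w g by rewrite /w dotBl fg subr0.
  by rewrite wg subrK.
by rewrite -{1}(es v vs) fg scale0r add0r es.
Qed.

End HilbertSpace.

Lemma summability_sum_words (R : realType) (n : nat) (g : word n -> R[i]) N :
  supp N g -> summability.sum (R := R[i]^o) g = \sum_(alpha <- words n N) g alpha.
Proof.
move=> gN; apply: (@cvg_lim R[i]^o); first exact: norm_hausdorff.
  exact: summability.totally_filter.
have FF := @summability.totally_filter (seq 'I_n).
apply: cvg_near_cst; exists [fset a in words n N]%fset => // B /= NB.
rewrite /summability.partial_sum -(big_seq_fsetE _ _ xpredT) /=.
rewrite (bigID (mem (words n N))) /= [X in _ + X]big1 ?addr0.
  rewrite -big_filter; apply: perm_big; apply: uniq_perm.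
  - by rewrite filter_uniq // fset_uniq.
  - exact: uniq_words.
  move=> a; rewrite mem_filter; apply: andb_idr => aN.
  by move/fsubsetP : NB; apply; rewrite inE.
by move=> a; rewrite mem_words -leqNgt; exact: gN.
Qed.

Section Compression.
Variables (R : realType) (H : normedModType R[i]) (dot : {dot H for Num.conj}).
Hypothesis dot_norm : forall x : H, `|x| ^+ 2 = dot x x.
Variables (n : nat) (T : 'I_n -> {linear H -> H}).
Hypothesis wT : (joint_numerical_radius dot (fun j => T j) <= 1)%E.

Lemma joint_form_le N (h : word n -> H) : supp N h ->
  complex.Re (\sum_(alpha <- words n N) \sum_(j < n)
    dot (h alpha) (T j (h (j :: alpha)))) <=
  \sum_(alpha <- words n N) rnorm (h alpha) ^+ 2.
Proof.
move=> hN; set X := \sum_(a <- words n N) rnorm _ ^+ 2.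
have X0 : 0 <= X by apply: sumr_ge0 => a _; exact: sqr_ge0.
have [XE|Xn] := eqVneq X 0.
  rewrite big1_seq ?X0 // => a /andP[_ aN].
  suff -> : h a = 0 by rewrite big1 // => j _; rewrite dot0l.
  apply: rnorm_eq0; move: XE => /eqP; rewrite psumr_eq0; last by move=> *; exact: sqr_ge0.
  by move=> /allP /(_ a aN) /=; rewrite sqrf_eq0 => /eqP.
have Xp : 0 < X by rewrite lt_def Xn.
pose c := (Num.sqrt X)^-1; pose g a := c%:C%C *: h a.
have c2 : c ^+ 2 = X^-1 by rewrite /c exprVn sqr_sqrtr.
have g2 a : rnorm (g a) ^+ 2 = X^-1 * rnorm (h a) ^+ 2.
  rewrite rnormZ exprMn rnorm_sqr conj_real.
  by rewrite -rmorphM /= -expr2 c2.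
have gN : supp N g by move=> a Na; rewrite /g hN // scaler0.
pose f (a : word n) := \sum_(j < n) dot (g a) (T j (g (j :: a))).
have fN : supp N f.
  by move=> a Na; rewrite /f big1 // => j _; rewrite gN // dot0l.
have : ((rnorm (summability.sum (R := R[i]^o) f))%:E <= 1)%E.
  apply: le_trans wT; apply: ereal_sup_ubound; exists g => //=.
  rewrite (@esum_words_supp _ _ _ N) => [|a|a Na]; last 2 first.
  - exact: sqr_ge0.
  - by rewrite gN // /rnorm normr0 expr0n.
  under eq_bigr do rewrite g2.
  by rewrite -mulr_sumr mulVf.
rewrite lee_fin (summability_sum_words fN) => /(le_trans (Re_le_rnorm _)).
have -> : \sum_(a <- words n N) f a = (X^-1)%:C%C *
   (\sum_(alpha <- words n N) \sum_(j < n) dot (h alpha) (T j (h (j :: alpha)))).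
  rewrite mulr_sumr; apply: eq_bigr => a _; rewrite mulr_sumr; apply: eq_bigr => j _.
  rewrite /g linearZ dotZl dotZr conj_real mulrA -rmorphM /= -expr2 c2.
  by [].
by rewrite complexRe_realM mulrC ler_pdivrMr // mul1r.
Qed.

Section Frame.
Variables (k : nat) (e : 'I_k -> H).
Hypothesis eON : orthonormal_family dot e.

Lemma rdot_frame c d : rdot c d = complex.Re (dot (frame e c) (frame e d)).
Proof. by rewrite -[c in LHS](coord_frame eON) rdotC rdot_coord. Qed.

Lemma compression_numrange : numrange_le (fun j => compression dot e (T j)) 1.
Proof.
move=> N h hN; rewrite mul1r.
have := @joint_form_le N (fun a => frame e (h a)).
have -> : \sum_(a <- words n N) rnorm (frame e (h a)) ^+ 2 =
          \sum_(a <- words n N) rdot (h a) (h a).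
  by apply: eq_bigr => a _; rewrite rdot_frame (rnorm_dot dot_norm).
rewrite complexRe_sum => h1; apply: le_trans (h1 _); last first.
  by move=> a Na; rewrite hN // frame0.
apply: ler_sum => a _; rewrite complexRe_sum; apply: ler_sum => j _.
by rewrite compressionE rdot_coord dotC complexRe_conj.
Qed.

Lemma word_mx_compression (D : nat) x :
  (forall alpha, (size alpha < D)%N ->
     frame e (coordinates dot e (word_op (fun j => T j) alpha x)) =
     word_op (fun j => T j) alpha x) ->
  forall alpha, (size alpha < D)%N ->
    word_mx (fun j => compression dot e (T j)) alpha *m coordinates dot e x =
    coordinates dot e (word_op (fun j => T j) alpha x).
Proof.
move=> Dx; elim=> [|j a IH] aD /=; first by rewrite mul1mx.
by rewrite -mulmxA IH ?(ltnW aD) // compressionE Dx // ltnW.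
Qed.

End Frame.

Lemma ncpoly_eval_words (p : word n -> R[i]) D x : supp D p ->
  ncpoly_eval (fun j => T j) p x =
  \sum_(alpha <- words n D) p alpha *: word_op (fun j => T j) alpha x.
Proof.
move=> pD; rewrite /ncpoly_eval.
rewrite -(@fsbig_widen _ _ _ _ [set` words n D]%classic) //.
  by rewrite -fsbig_seq // uniq_words.
move=> a /= [_ aD].
rewrite pD ?scale0r // leqNgt; apply/negP => aD'; apply: aD.
by rewrite /= mem_words.
Qed.

End Compression.

(** The passage to [c = 1] in a polynomial; Bernoulli's [1 - c ^+ k <= k (1 - c)] supplies an
    explicit modulus of continuity. *)
Lemma sum_pow_le (R : realFieldType) (I : Type) (r : seq I) (m : I -> nat)
    (a : I -> R) (K : R) :
  (forall c, 0 < c -> c < 1 -> \sum_(i <- r) c ^+ m i * a i <= K) ->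
  \sum_(i <- r) a i <= K.
Proof.
move=> Hc; have bern (c : R) k : 0 < c -> c < 1 -> 0 <= 1 - c ^+ k <= k%:R * (1 - c).
  move=> c0 c1; elim: k => [|k /andP[IH1 IH2]].
    by rewrite expr0 subrr mul0r lexx.
  have ck : 0 <= c ^+ k by rewrite exprn_ge0 // ltW.
  by rewrite exprS -natr1; apply/andP; split; nra.
pose M := \sum_(i <- r) (m i)%:R * `|a i|.
have M0 : 0 <= M by apply: sumr_ge0 => i _; rewrite mulr_ge0.
apply/ler_addgt0Pr => d d0.
pose t := Num.min (2^-1) (d / (M + 1)).
have M1 : 0 < M + 1 by rewrite ltr_wpDl.
have t0 : 0 < t by rewrite lt_min invr_gt0 ltr0n divr_gt0.
have t1 : t <= 2^-1 by rewrite ge_min lexx.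
have tM : t * M <= d.
  apply: le_trans (_ : d / (M + 1) * M <= _).
    by rewrite ler_wpM2r // ge_min lexx orbT.
  by rewrite -mulrA ler_piMr ?(ltW d0) // mulrC ler_pdivrMr // mul1r lerDl.
have c0 : 0 < 1 - t by lra.
have c1 : 1 - t < 1 by lra.
have := Hc _ c0 c1.
suff : \sum_(i <- r) a i <= \sum_(i <- r) (1 - t) ^+ m i * a i + t * M.
  by move=> h1 h2; lra.
rewrite /M mulr_sumr -big_split /=; apply: ler_sum => i _.
have /andP[b1 b2] := bern _ (m i) c0 c1.
have n0 := ler_norm (a i); have n1 := normr_ge0 (a i).
have : (1 - (1 - t) ^+ m i) * a i <= (m i)%:R * (1 - (1 - t)) * `|a i|.
  apply: le_trans (_ : (1 - (1 - t) ^+ m i) * `|a i| <= _).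
    by rewrite ler_wpM2l.
  by rewrite ler_wpM2r.
lra.
Qed.

(** * The two bounds for polynomials in the operators *)

Section PolynomialCalculus.
Variables (R : realType) (H : normedModType R[i]) (dot : {dot H for Num.conj}).
Hypothesis dot_norm : forall x : H, `|x| ^+ 2 = dot x x.
Variables (n : nat) (T : 'I_n -> {linear H -> H}).
Hypothesis wT : (joint_numerical_radius dot (fun j => T j) <= 1)%E.

Lemma ncpoly_eval_bounds (p : word n -> R[i]) x : ncpoly p -> tens_bound p 1 ->
  let z := ncpoly_eval (fun j => T j) p x in
  rnorm z <= 2 * rnorm x /\ rnorm (dot z x) <= 5 / 4 * rnorm x ^+ 2.
Proof.
move=> /ncpolyP[D0 pD0] p1 z.
pose D := D0.+1; have pD : supp D p by move=> a Da; apply: pD0; exact: ltnW.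
have [k [e [eON es]]] :=
  exists_frame dot_norm [seq word_op (fun j => T j) a x | a <- words n D].
have spanx a : (size a < D)%N ->
    frame e (coordinates dot e (word_op (fun j => T j) a x)) =
    word_op (fun j => T j) a x.
  by move=> aD; apply: es; apply/mapP; exists a; rewrite ?mem_words.
pose pi := coordinates dot e.
have xE : frame e (pi x) = x by exact: (spanx [::]).
have piD : {morph pi : u v / u + v} by exact: coordinatesD.
have pi0 : pi 0 = 0 by exact: coordinates0.
have piz : pi z = \sum_(a <- words n D) p a *: pi (word_op (fun j => T j) a x).
  rewrite /z (ncpoly_eval_words _ _ pD) (big_morph pi piD pi0).
  by apply: eq_bigr => a _; rewrite /pi coordinatesZ.
have zE : frame e (pi z) = z.
  rewrite piz (big_morph (frame e) (@frameD _ _ _ e) (frame0 e)).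
  rewrite [RHS](ncpoly_eval_words _ _ pD) !big_seq; apply: eq_bigr => a.
  by rewrite mem_words => aD; rewrite frameZ spanx.
(* Scaling [p] by [c] makes the constant term strictly smaller than 1 in modulus; together with the
   [c ^+ 2] on the operators, the word [a] carries the power [(2 * size a).+1]. *)
pose zc (c : R) := poly_mx (fun j => (c ^+ 2)%:C%C *: compression dot e (T j))
  (fun a => c%:C%C * p a) D *m pi x.
have zcE c u : rdot u (zc c) = \sum_(a <- words n D) c ^+ (2 * size a).+1 *
    rdot u (p a *: pi (word_op (fun j => T j) a x)).
  rewrite /zc /poly_mx mulmx_suml rdot_sumr !big_seq; apply: eq_bigr => a.
  rewrite mem_words => aD; rewrite word_mxZ -!scalemxAl.
  rewrite (word_mx_compression spanx aD) -rdotZr; congr rdot.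
  rewrite !scalerA; congr (_ *: _).
  have cX m (d : R) : (d ^+ m)%:C%C = d%:C%C ^+ m :> R[i] by rewrite rmorphXn.
  have -> : (c ^+ (2 * size a).+1)%:C%C = c%:C%C * (c ^+ 2)%:C%C ^+ size a.
    by rewrite exprS exprM -cX -rmorphM.
  by rewrite mulrAC.
have bound (c : R) : 0 < c -> c < 1 ->
    rdot (zc c) (zc c) <= 4 * rdot (pi x) (pi x) /\
    forall zeta : R[i], complex.Re (zeta^* * zeta) = 1 ->
    rdot (zeta *: pi x) (zc c) <= 5 / 4 * rdot (pi x) (pi x).
  move=> c0 c1; apply: poly_mx_bounds => //.
  - exact: compression_numrange.
  - by move=> a Da; rewrite pD // mulr0.
  - move=> N phi phiN L; apply: le_trans (tens_bound_contractive p1 phiN L).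
    have -> : nsq L (vtensor (fun a => c%:C%C * p a) phi) =
              nsq L (fun a => c%:C%C *: vtensor p phi a).
      apply: eq_bigr => a _; suff -> : vtensor (fun a0 => c%:C%C * p a0) phi a =
        c%:C%C *: vtensor p phi a by [].
      by rewrite scaler_sumr; apply: eq_bigr => l _; rewrite scalerA.
    rewrite nsqZ conj_real -rmorphM /= ler_piMl ?nsq_ge0 //.
    by nra.
  - have := tens_bound_coef0 p1; rewrite -!rnorm_sqr.
    have -> : rnorm (c%:C%C * p [::]) = c * rnorm (p [::]).
      rewrite (@rnormZ _ R[i]^o c%:C%C) {1}/rnorm normc_def /= expr0n addr0 sqrtr_sqr.
      by rewrite ger0_norm // ltW.
    rewrite exprMn => p01; have : c ^+ 2 < 1 by rewrite expr2; nra.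
    have := sqr_ge0 (rnorm (p [::])); have := exprn_gt0 2 c0.
    move: (rnorm _ ^+ 2) p01 (c ^+ 2) => r r1 s s0 r0 s1; nra.
have lim u K : (forall c : R, 0 < c -> c < 1 -> rdot u (zc c) <= K) -> rdot u (pi z) <= K.
  move=> h; rewrite piz rdot_sumr; apply: (@sum_pow_le _ _ _ (fun a => (2 * size a).+1)).
  by move=> c c0 c1; rewrite -zcE; exact: h.
have xx : rdot (pi x) (pi x) = rnorm x ^+ 2.
  by rewrite (rdot_frame eON) xE (rnorm_dot dot_norm).
have zz : rdot (pi z) (pi z) = rnorm z ^+ 2.
  by rewrite (rdot_frame eON) zE (rnorm_dot dot_norm).
split.
  apply: ler_sqr_lin; first by rewrite mulr_ge0 // rnorm_ge0.
  (* [lim] handles only linear functionals of [zc c], so the quadratic bound is first linearized by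
     [2 <z, zc> <= |z|^2 + |zc|^2]. *)
  have : rdot (pi z) (pi z) <= 2^-1 * (rdot (pi z) (pi z) + 4 * rdot (pi x) (pi x)).
    apply: lim => c c0 c1; have [b _] := bound c c0 c1.
    have := rdot_ge0 (pi z - zc c).
    by rewrite rdotBl !rdotBr (rdotC (zc c)); lra.
  by rewrite zz xx; lra.
set w := dot z x.
have [->|wn] := eqVneq w 0.
  by rewrite {1}/rnorm normr0 mulr_ge0 ?sqr_ge0 //; lra.
have rw : rnorm w != 0.
  by apply: contra wn => /eqP h; rewrite -normr_eq0 (@rnormE _ R[i]^o) h.
pose zeta := ((rnorm w)^-1)%:C%C * w.
have ww : w^* * w = (rnorm w ^+ 2)%:C%C.
  rewrite rnorm_sqr; case: (w) => c d; apply/eqP; rewrite eq_complex /= eqxx.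
  by apply/eqP; ring.
have zw : zeta^* * w = (rnorm w)%:C%C.
  rewrite rmorphM /= conj_real -mulrA ww -rmorphM /=; congr (_%:C%C).
  by field.
have z1 : complex.Re (zeta^* * zeta) = 1.
  rewrite {2}/zeta mulrCA zw -rmorphM /=.
  by field.
have : rdot (zeta *: pi x) (pi z) <= 5 / 4 * rdot (pi x) (pi x).
  by apply: lim => c c0 c1; have [_] := bound c c0 c1; apply.
rewrite xx (rdot_frame eON) zE frameZ xE dotZl dotC -complexRe_conj rmorphM /= conjCK.
by rewrite -/w zw.
Qed.

End PolynomialCalculus.

(** * Extension to the noncommutative disc algebra *)

Lemma cauchy_rate_limit (R : realType) (H : completeNormedModType R[i])
    (u : nat -> H) (C : R) :
  (forall k l, (k <= l)%N -> rnorm (u k - u l) <= C / k.+1%:R) ->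
  exists L, forall k, rnorm (L - u k) <= C / k.+1%:R.
Proof.
move=> uC.
have small (d : R) : 0 < d -> exists k : nat, C / k.+1%:R < d.
  move=> d0; have C0 : 0 <= `|C| / d by rewrite divr_ge0 // ltW.
  exists (Num.bound (`|C| / d)).
  have := archi_boundP C0; rewrite ltr_pdivrMr // => h.
  rewrite ltr_pdivrMr ?ltr0n // mulrC; apply: le_lt_trans (ler_norm C) _.
  by apply: lt_trans h _; rewrite ltr_pM2r // ltr_nat.
have : cvg (u @ \oo)%classic.
  apply/cauchy_cvgP; apply: cauchy_exP => e e0.
  have eE : e = (complex.Re e)%:C%C.
    by move: e0; case: (e) => a b; rewrite ltcE /= => /andP[/eqP -> _].
  have : 0 < complex.Re e by move: e0; rewrite {1}eE ltcR.
  move=> /small[k kd]; exists (u k), k => // l /= kl.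
  rewrite -ball_normE /= rnormE eE ltcR.
  exact: le_lt_trans (uC _ _ kl) kd.
move=> /cvg_ex[L uL]; exists L => k; apply/ler_addgt0Pr => d d0.
have d0' : 0 < d%:C%C :> R[i] by rewrite ltcR.
have /cvgrPdist_lt/(_ _ d0')[N _ NL] := uL.
pose l := maxn k N.
have := NL l (leq_maxr _ _); rewrite rnormE ltcR => Ll.
have kl := uC k l (leq_maxl _ _).
have -> : L - u k = (L - u l) - (u k - u l) by rewrite opprB addrA subrK.
have : rnorm (L - u l - (u k - u l)) <= rnorm (L - u l) + rnorm (u k - u l).
  have := ler_normB (L - u l) (u k - u l).
  by rewrite !rnormE -rmorphD lecR.
by move=> h; apply: le_trans h _; rewrite addrC lerD // ltW.
Qed.

Section Extension.
Variables (R : realType) (H : completeNormedModType R[i]).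
Variables (dot : {dot H for Num.conj}).
Hypothesis dot_norm : forall x : H, `|x| ^+ 2 = dot x x.
Variables (n : nat) (T : 'I_n -> bounded_op H).
Hypothesis wT : (joint_numerical_radius dot T <= 1)%E.
Implicit Types (p : word n -> R[i]) (x : H).

Lemma rnormB_le x y : rnorm (x - y) <= rnorm x + rnorm y.
Proof. by have := ler_normB x y; rewrite !rnormE -rmorphD lecR. Qed.

Lemma rnorm_dist x y : rnorm (x - y) = rnorm (y - x).
Proof. by rewrite /rnorm distrC. Qed.

Lemma dot_le x y : rnorm (dot x y) <= rnorm x * rnorm y.
Proof.
apply: ler_sqr_lin; first by rewrite mulr_ge0 // rnorm_ge0.
rewrite exprMn rnorm_sqr.
set w := dot x y.
have -> : complex.Re (w^* * w) = complex.Re w ^+ 2 + complex.Im w ^+ 2.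
  by case: (w) => a b /=; ring.
apply: discr_le; [exact: sqr_ge0|exact: sqr_ge0|move=> l1 l2].
have := sqr_ge0 (rnorm (x - Complex l1 l2 *: y)).
have dotBr u v z : dot z (u - v) = dot z u - dot z v by exact: linearBr.
rewrite (rnorm_dot dot_norm) dotBl !dotBr !dotZl !dotZr (dotC dot x y) -/w.
rewrite !(dot_real dot_norm) /=.
case: (w) => a b /=; nra.
Qed.

Let ev p x := ncpoly_eval (fun j => T j) p x.

Lemma ncpolyB p r : ncpoly p -> ncpoly r -> ncpoly (fun a => p a - r a).
Proof.
move=> /ncpolyP[N pN] /ncpolyP[M rM]; apply/ncpolyP; exists (maxn N M) => a.
by rewrite geq_max => /andP[Na Ma]; rewrite pN // rM // subr0.
Qed.

Lemma evB p r x : ncpoly p -> ncpoly r -> ev (fun a => p a - r a) x = ev p x - ev r x.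
Proof.
move=> /ncpolyP[N pN] /ncpolyP[M rM].
have pL : supp (maxn N M) p by move=> a; rewrite geq_max => /andP[Na _]; exact: pN.
have rL : supp (maxn N M) r by move=> a; rewrite geq_max => /andP[_ Na]; exact: rM.
have prL : supp (maxn N M) (fun a => p a - r a).
  by move=> a Na; rewrite pL // rL // subr0.
rewrite /ev (ncpoly_eval_words _ _ pL) (ncpoly_eval_words _ _ rL).
rewrite (ncpoly_eval_words _ _ prL).
by rewrite -sumrB; apply: eq_bigr => a _; rewrite scalerBl.
Qed.

Lemma word_opP (a : word n) (c : R[i]) x y :
  word_op T a (c *: x + y) = c *: word_op T a x + word_op T a y.
Proof. by elim: a => //= j a ->; rewrite linearP. Qed.

Lemma evP p (c : R[i]) x y : ncpoly p -> ev p (c *: x + y) = c *: ev p x + ev p y.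
Proof.
move=> /ncpolyP[N pN]; rewrite /ev !(ncpoly_eval_words _ _ pN) scaler_sumr -big_split.
by apply: eq_bigr => a _; rewrite word_opP scalerDr !scalerA mulrC.
Qed.

Lemma tens_boundZ p (c C : R) : 0 <= c -> tens_bound p C ->
  tens_bound (fun a => c%:C%C * p a) (c * C).
Proof.
move=> c0 pC N phi phiN L; rewrite exprMn -mulrA.
apply: le_trans (ler_wpM2l (sqr_ge0 c) (pC N phi phiN L)).
rewrite mulr_sumr; apply: ler_sum => a _.
have -> : tensor (fun a0 => c%:C%C * p a0) phi a = c%:C%C * tensor p phi a.
  by rewrite mulr_sumr; apply: eq_bigr => l _; rewrite mulrA.
rewrite !rnorm_sqr rmorphM /= conj_real.
by case: (tensor p phi a) => u v /=; rewrite le_eqVlt; apply/orP; left; apply/eqP; ring.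
Qed.

Lemma ev_bounds p (C : R) x : ncpoly p -> 0 < C -> tens_bound p C ->
  rnorm (ev p x) <= 2 * C * rnorm x /\
  rnorm (dot (ev p x) x) <= 5 / 4 * C * rnorm x ^+ 2.
Proof.
move=> pP C0 pC; have Ci : 0 <= C^-1 by rewrite invr_ge0 ltW.
pose r a := (C^-1)%:C%C * p a.
have rP : ncpoly r.
  by move: pP => /ncpolyP[N pN]; apply/ncpolyP; exists N => a Na; rewrite /r pN // mulr0.
have := tens_boundZ Ci pC; rewrite mulVf ?gt_eqF // => r1.
have evE : ev p x = C%:C%C *: ev r x.
  move: pP => /ncpolyP[N pN].
  have rN : supp N r by move=> a Na; rewrite /r pN // mulr0.
  rewrite /ev (ncpoly_eval_words _ _ pN) (ncpoly_eval_words _ _ rN) scaler_sumr.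
  apply: eq_bigr => a _; rewrite scalerA /r mulrA -rmorphM /= mulfV ?gt_eqF //.
  by rewrite mul1r.
have rC : rnorm (C%:C%C : R[i]) = C.
  by rewrite /rnorm normc_def /= expr0n addr0 sqrtr_sqr ger0_norm // ltW.
have [b1 b2] := ncpoly_eval_bounds dot_norm wT x rP r1.
rewrite evE rnormZ rC dotZl (@rnormZ _ R[i]^o C%:C%C) rC; split.
  by rewrite [2 * C]mulrC -mulrA ler_pM2l.
by rewrite [5 / 4 * C]mulrC -mulrA ler_pM2l.
Qed.


Lemma disc_algebra_approx (a : disc_algebra R n) (e : R) : 0 < e ->
  exists2 p, ncpoly p & tens_bound (fun b => \val a b - p b) e.
Proof.
move=> e0; have [_ /(_ e e0)[p pP ape]] := set_valP a.
by exists p => //; apply/norm_infty_leP; [exact: ltW|exact: ltW].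
Qed.

Lemma disc_algebra_bound (a : disc_algebra R n) :
  exists2 C : R, 0 < C & tens_bound (\val a) C.
Proof.
have [[_ aoo] _] := set_valP a.
have [C C0 aC] : exists2 C : R, 0 < C & (norm_infty (\val a) <= C%:E)%E.
  case: (norm_infty (\val a)) aoo => [r _|//|_]; last by exists 1 => //; exact: leNye.
  by exists (`|r| + 1); rewrite ?ltr_wpDl // lee_fin (le_trans (ler_norm r)) // lerDl.
by exists C => //; apply/norm_infty_leP => //; exact: ltW.
Qed.

Lemma tens_bound_add p r (C1 C2 : R) : 0 < C1 -> 0 < C2 ->
  tens_bound r C1 -> tens_bound (fun b => r b - p b) C2 -> tens_bound p (C1 + C2).
Proof.
move=> C10 C20 rC rpC; have := tens_boundB C10 C20 rC rpC.
by congr tens_bound; apply: boolp.funext => b; rewrite subKr.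
Qed.

Lemma tens_bound_dist p r s (C1 C2 : R) : 0 < C1 -> 0 < C2 ->
  tens_bound (fun b => r b - p b) C1 -> tens_bound (fun b => r b - s b) C2 ->
  tens_bound (fun b => s b - p b) (C1 + C2).
Proof.
move=> C10 C20 rC rpC; have := tens_boundB C10 C20 rC rpC.
congr tens_bound; apply: boolp.funext => b.
by rewrite opprB addrC addrA subrK.
Qed.

Lemma tens_bound_distC p r (C : R) :
  tens_bound (fun b => p b - r b) C -> tens_bound (fun b => r b - p b) C.
Proof.
move=> prC N phi phiN L; apply: le_trans (prC N phi phiN L); apply: ler_sum => a _.
rewrite le_eqVlt; apply/orP; left; apply/eqP; rewrite !rnorm_sqr.
have -> : tensor (fun b => r b - p b) phi a = - tensor (fun b => p b - r b) phi a.
  by rewrite -sumrN; apply: eq_bigr => l _; rewrite -mulNr opprB.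
by rewrite rmorphN mulrNN.
Qed.

Lemma tens_bound_subrr p (C : R) : tens_bound (fun b => p b - p b) C.
Proof.
move=> N phi phiN L; rewrite big1 => [|a _].
  by apply: mulr_ge0; [exact: sqr_ge0|apply: sumr_ge0 => a _; exact: sqr_ge0].
rewrite rnorm_sqr (_ : tensor _ _ _ = 0) ?mulr0 //.
by apply: big1 => l _; rewrite /= subrr mul0r.
Qed.

Lemma ncpoly_disc_algebra p (C : R) : ncpoly p -> 0 < C -> tens_bound p C ->
  disc_algebra R n p.
Proof.
move=> pP C0 pC.
have poo : (norm_infty p <= C%:E)%E by apply/norm_infty_leP => //; exact: ltW.
split; last first.
  move=> e e0; exists p => //; apply: (@le_lt_trans _ _ 0%:E); last by rewrite lte_fin.
  by apply/norm_infty_leP => //; exact: tens_bound_subrr.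
split; last exact: le_lt_trans poo (ltry _).
(* Testing [norm_infty] on the vacuum vector, where [p (x) 1 = p], shows that [p] is
   square-summable. *)
pose one (a : word n) : R[i] := if a is [::] then 1 else 0.
apply: (@le_lt_trans _ _ C%:E); last exact: ltry.
apply: le_trans poo; apply: ereal_sup_ubound; exists one.
  split; first by apply/ncpolyP; exists 1%N; case.
  apply/norm2_leP => // -[|N]; first by rewrite big_nil expr1n.
  rewrite sum_words_cons big1 => [|j _]; last first.
    by rewrite big1 // => a _; rewrite rnorm_sqr rmorph0 mul0r.
  by rewrite addr0 rnorm_sqr rmorph1 mul1r expr1n.
congr norm2; apply: boolp.funext => a.
rewrite /tensor big_ord_recr /= big1 => [|l _].
  by rewrite take_size drop_size mulr1 add0r.
suff -> : one (drop l a) = 0 by rewrite mulr0.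
have : (0 < size (drop l a))%N by rewrite size_drop subn_gt0.
by case: (drop l a).
Qed.

(* [L] is the value at [x] of the extension of [p |-> p(T)] to [a]. *)
Let is_ext a x L := forall p (C : R), ncpoly p -> 0 < C ->
  tens_bound (fun b => a b - p b) C -> rnorm (L - ev p x) <= 2 * C * rnorm x.

Lemma exists_ext (a : disc_algebra R n) x : exists L, is_ext (\val a) x L.
Proof.
have inv0 k : 0 < k.+1%:R^-1 :> R by rewrite invr_gt0 ltr0n.
have /boolp.choice[ps psP] : forall k : nat, exists p,
    ncpoly p /\ tens_bound (fun b => \val a b - p b) k.+1%:R^-1.
  by move=> k; have [p pP ap] := disc_algebra_approx a (inv0 k); exists p.
have diff k p (C : R) : ncpoly p -> 0 < C -> tens_bound (fun b => \val a b - p b) C ->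
    rnorm (ev (ps k) x - ev p x) <= 2 * (C + k.+1%:R^-1) * rnorm x.
  move=> pP C0 pC; have [kP kC] := psP k.
  rewrite -evB //.
  have B := tens_bound_dist C0 (inv0 k) pC kC.
  by have [] := ev_bounds x (ncpolyB kP pP) (addr_gt0 C0 (inv0 k)) B.
have [|L LP] := @cauchy_rate_limit R H (fun k => ev (ps k) x) (4 * rnorm x).
  move=> k l kl; have [lP lC] := psP l.
  apply: le_trans (diff k _ _ lP (inv0 l) lC) _.
  rewrite -[X in _ <= X]mulrA [rnorm x * _]mulrC mulrA ler_wpM2r ?rnorm_ge0 //.
  have : l.+1%:R^-1 <= k.+1%:R^-1 :> R by rewrite lef_pV2 ?posrE ?ltr0n // ler_nat.
  by move: (l.+1%:R^-1) (k.+1%:R^-1) => s t st; lra.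
exists L => p C pP C0 pC; apply/ler_addgt0Pr => d d0.
have x0 : 0 <= 6 * rnorm x / d by rewrite divr_ge0 ?mulr_ge0 ?rnorm_ge0 // ltW.
pose k := Num.bound (6 * rnorm x / d).
have kd : 6 * rnorm x * k.+1%:R^-1 <= d.
  rewrite ler_pdivrMr ?ltr0n // [d * _]mulrC -ler_pdivrMr //.
  by apply: le_trans (ltW (archi_boundP x0)) _; rewrite ler_nat.
have h3 := diff k p C pP C0 pC; have h2 := LP k.
have h1 := rnormB_le (L - ev (ps k) x) (ev p x - ev (ps k) x).
rewrite opprB addrA subrK (rnorm_dist (ev p x) (ev (ps k) x)) in h1.
move: (k.+1%:R^-1) kd h2 h3 => t kd h2 h3; lra.
Qed.

Lemma small_eq0 x (K : R) : (forall C : R, 0 < C -> rnorm x <= C * K) -> x = 0.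
Proof.
move=> h; apply: rnorm_eq0; apply/eqP; rewrite eq_le rnorm_ge0 andbT.
have K0 : 0 <= K by have := h 1 ltr01; rewrite mul1r; apply: le_trans; exact: rnorm_ge0.
apply/ler_addgt0Pr => d d0; rewrite add0r.
have K1 : 0 < K + 1 by rewrite ltr_wpDl.
apply: le_trans (h (d / (K + 1)) (divr_gt0 d0 K1)) _.
by rewrite -mulrA ler_piMr ?(ltW d0) // mulrC ler_pdivrMr // mul1r lerDl.
Qed.

Lemma exists_continuous_extension :
  exists Psi : disc_algebra R n -> bounded_op H, continuous_extension T Psi.
Proof.
have /boolp.choice[f fP] : forall ax : disc_algebra R n * H, exists L,
    is_ext (\val ax.1) ax.2 L by move=> [a x]; exact: exists_ext.
pose F a x := f (a, x); have {}fP a x : is_ext (\val a) x (F a x) by exact: fP (a, x).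
have lin a : linear (F a).
  move=> c x y; apply/eqP; rewrite -subr_eq0; apply/eqP.
  apply: (@small_eq0 _ (2 * rnorm (c *: x + y) + rnorm c * (2 * rnorm x) + 2 * rnorm y)).
  (* One polynomial near [a] serves all three vectors, since [is_ext] compares with every
     approximant and not only with a chosen sequence. *)
  move=> C C0; have [p pP ap] := disc_algebra_approx a C0.
  have := fP a (c *: x + y) p C pP C0 ap; have := fP a x p C pP C0 ap.
  have := fP a y p C pP C0 ap; rewrite evP //.
  set u := F a (c *: x + y); set v := F a x; set w := F a y => hw hv hu.
  have -> : u - (c *: v + w) =
      (u - (c *: ev p x + ev p y)) - (c *: (v - ev p x) - (ev p y - w)).
    rewrite scalerBr opprB (_ : ev p y - w - (c *: v - c *: ev p x) =
        c *: ev p x + ev p y - (c *: v + w)); first by rewrite addrA subrK.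
    by rewrite opprB addrACA [ev p y + _]addrC [in RHS]addrC opprD [in RHS]addrC [- w + _]addrC.
  apply: le_trans (rnormB_le _ _) _.
  have h2 := rnormB_le (c *: (v - ev p x)) (ev p y - w).
  rewrite rnormZ (rnorm_dist (ev p y)) in h2.
  have h3 := ler_wpM2l (rnorm_ge0 (c : R[i]^o)) hv.
  by rewrite mulrDr mulrDr; lra.
have bnd a : exists2 K : R, 0 <= K & forall x, rnorm (F a x) <= K * rnorm x.
  have [C C0 aC] := disc_algebra_bound a.
  have [p pP ap] := disc_algebra_approx a ltr01.
  exists (2 * (C + 1) + 2) => [|x]; first by lra.
  have [h1 _] := ev_bounds x pP (addr_gt0 C0 ltr01) (tens_bound_add C0 ltr01 aC ap).
  have h2 := fP a x p 1 pP ltr01 ap.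
  have := rnormB_le (F a x - ev p x) (- ev p x); rewrite opprK subrK.
  have -> : rnorm (- ev p x) = rnorm (ev p x) by rewrite /rnorm normrN.
  lra.
pose linF a : {linear H -> H} := HB.pack (F a) (GRing.isLinear.Build _ _ _ _ (F a) (lin a)).
have cont a : continuous (linF a).
  apply/linear_bounded_continuous/linear_boundedP.
  have [K K0 FK] := bnd a; near=> r => x.
  have Kr : (K%:C%C : R[i]) <= r.
    by near: r; apply: nbhs_pinfty_ge; rewrite ger0_real // lecR.
  apply: le_trans (_ : K%:C%C * `|x| <= _); last by rewrite ler_wpM2r.
  by rewrite !rnormE -rmorphM lecR; exact: FK.
exists (fun a => BoundedOp (cont a)); split.
  move=> a aP x; apply/eqP; rewrite -subr_eq0; apply/eqP.
  apply: (@small_eq0 _ (2 * rnorm x)) => C C0.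
  by rewrite mulrCA mulrA; apply: fP => //; exact: tens_bound_subrr.
(* With [p] within [e / 16] of [a], the error is at most [2 (e/8 + e/16) + 2 (e/16) = e/2]; the
   slack keeps the supremum strictly below [e]. *)
move=> a e e0; exists (e / 8) => [|b ba]; first by rewrite divr_gt0.
have e8 : 0 < e / 8 by rewrite divr_gt0.
have e16 : 0 < e / 16 by rewrite divr_gt0.
have {}ba : tens_bound (fun w => \val b w - \val a w) (e / 8).
  by apply/norm_infty_leP; exact: ltW.
have [p pP ap] := disc_algebra_approx a e16.
have bp : tens_bound (fun w => \val b w - p w) (e / 8 + e / 16).
  have pa := tens_bound_distC ap.
  have := tens_boundB e8 e16 ba pa; congr tens_bound; apply: boolp.funext => w.
  by rewrite opprB addrA subrK.
apply: (@le_lt_trans _ _ (e / 2)%:E); last by rewrite lte_fin; lra.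
apply: ge_ereal_sup => _ [x /= x1 <-]; rewrite lee_fin.
have h1 := fP b x p _ pP (addr_gt0 e8 e16) bp.
have h2 := fP a x p _ pP e16 ap.
have -> : F b x - F a x = (F b x - ev p x) - (F a x - ev p x).
  by rewrite opprB addrA subrK.
apply: le_trans (rnormB_le _ _) _.
have := rnorm_ge0 x.
nra.
Unshelve. all: by end_near.
Qed.

Lemma extension_approx (Psi : disc_algebra R n -> bounded_op H) a (e : R) :
  continuous_extension T Psi -> (norm_infty (\val a) <= 1)%E -> 0 < e ->
  exists2 p, ncpoly p /\ tens_bound p (1 + e) &
    forall x, rnorm x <= 1 -> rnorm (Psi a x - ev p x) <= e.
Proof.
move=> [Psi_poly Psi_cont] a1 e0; have [d d0 Psi_d] := Psi_cont a e e0.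
(* [t <= e] keeps the approximant within norm [1 + e], and [t < d] brings it into the range where
   the continuity of [Psi] at [a] applies. *)
pose t := Num.min e (d / 2).
have t0 : 0 < t by rewrite lt_min e0 divr_gt0.
have [p pP ap] := disc_algebra_approx a t0.
have a1' : tens_bound (\val a) 1 by apply/norm_infty_leP.
have pt := tens_bound_add ltr01 t0 a1' ap.
have pA := ncpoly_disc_algebra pP (addr_gt0 ltr01 t0) pt.
pose b : disc_algebra R n := SigSub (mem_set pA).
have te : t <= e by rewrite ge_min lexx.
have td : t < d by rewrite gt_min orbC (_ : d / 2 < d) //; lra.
exists p => [|x x1].
  split=> // N phi phiN L; apply: le_trans (pt N phi phiN L) _.
  apply: ler_wpM2r; first by apply: sumr_ge0 => w _; exact: sqr_ge0.
  by rewrite !expr2; nra.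
have ba : (norm_infty (\val b \- \val a)%R < d%:E)%E.
  apply: (@le_lt_trans _ _ t%:E); last by rewrite lte_fin.
  by apply/norm_infty_leP; [exact: ltW|exact: tens_bound_distC].
have := Psi_d b ba; rewrite /ev -(Psi_poly b pP x) rnorm_dist => /ltW h.
rewrite -lee_fin; apply: le_trans h.
by apply: ereal_sup_ubound; exists x.
Qed.

Lemma extension_bounds (Psi : disc_algebra R n -> bounded_op H) :
  continuous_extension T Psi ->
  (map_norm Psi <= 2%:E)%E /\ (map_wnorm dot Psi <= (5 / 4)%:E)%E.
Proof.
move=> PsiT; split; apply: ge_ereal_sup => _ [a /= a1 <-];
  apply: ge_ereal_sup => _ [x /= x1 <-]; rewrite lee_fin;
  apply/ler_addgt0Pr => d d0.
  have d4 : 0 < d / 4 by rewrite divr_gt0.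
  have [p [pP p1] /(_ x x1) h1] := extension_approx PsiT a1 d4.
  have [h2 _] := ev_bounds x pP (addr_gt0 ltr01 d4) p1.
  have := rnormB_le (Psi a x - ev p x) (- ev p x); rewrite opprK subrK.
  have -> : rnorm (- ev p x) = rnorm (ev p x) by rewrite /rnorm normrN.
  have := rnorm_ge0 x.
  nra.
have d4 : 0 < d / 4 by rewrite divr_gt0.
have x1' : rnorm x <= 1 by rewrite x1.
have [p [pP p1] /(_ x x1') h1] := extension_approx PsiT a1 d4.
have [_ h2] := ev_bounds x pP (addr_gt0 ltr01 d4) p1.
have -> : dot (Psi a x) x = dot (Psi a x - ev p x) x - - dot (ev p x) x.
  by rewrite opprK dotBl subrK.
have h3 : rnorm (dot (Psi a x - ev p x) x - - dot (ev p x) x) <=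
    rnorm (dot (Psi a x - ev p x) x) + rnorm (dot (ev p x) x).
  have := ler_normB (dot (Psi a x - ev p x) x) (- dot (ev p x) x).
  by rewrite normrN !(@rnormE _ R[i]^o) -rmorphD lecR.
have h4 := dot_le (Psi a x - ev p x) x.
rewrite x1 in h2 h4; rewrite expr1n in h2; lra.
Qed.

End Extension.

Theorem theorem6p1 (R : realType) (H : completeNormedModType R[i])
    (dot : {dot H for Num.conj})
    (dot_norm : forall x : H, `|x| ^+ 2 = dot x x)
    (n : nat) (n_ge1 : (1 <= n)%N) (T : 'I_n -> bounded_op H)
    (wT : (joint_numerical_radius dot T <= 1)%E) :
  (exists Psi : disc_algebra R n -> bounded_op H, continuous_extension T Psi) /\
  (forall Psi : disc_algebra R n -> bounded_op H, continuous_extension T Psi ->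
     (map_norm Psi <= 2%:E)%E /\ (map_wnorm dot Psi <= (5 / 4)%:E)%E).
Proof.
split; first exact: (exists_continuous_extension dot_norm wT).
by move=> Psi; apply: (extension_bounds dot_norm wT).
Qed.
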